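(* HyperLTL and HyperFO are equally expressive: for every HyperFO sentence $\varphi$ there is a HyperLTL sentence $\varphi'$ such that for every set $T$ of traces over $AP$, $\mathcal{M}(T)\models\varphi$ iff $T\models\varphi'$; and for every HyperLTL sentence $\varphi$ there is a HyperFO sentence $\varphi'$ such that for every set $T$ of traces over $AP$, $T\models\varphi$ iff $\mathcal{M}(T)\models\varphi'$.
   Context: Fix a finite set $AP$ of atomic propositions. A trace over $AP$ is a map $t:\mathbb{N}\to 2^{AP}$. HyperLTL formulas are given by the grammar $\varphi ::= \exists \pi.\ \varphi \mid \forall \pi.\ \varphi \mid \psi$ and $\psi ::= a_\pi \mid \neg\psi \mid \psi\vee\psi \mid \mathbf{X}\psi \mid \psi\,\mathbf{U}\,\psi$, where $a\in AP$ and $\pi$ ranges over a countable set of trace variables. For a set $T$ of traces and a trace assignment $\Pi$ (a partial map from trace variables to traces), with $\Pi[j]$ mapping each $\pi$ in the domain of $\Pi$ to the suffix $\Pi(\pi)(j)\Pi(\pi)(j+1)\cdots$: $(T,\Pi)\models a_\pi$ iff $a\in\Pi(\pi)(0)$; negation and disjunction as usual; $(T,\Pi)\models\mathbf{X}\psi$ iff $(T,\Pi[1])\models\psi$; $(T,\Pi)\models\psi_1\mathbf{U}\psi_2$ iff there is $j\ge0$ with $(T,\Pi[j])\models\psi_2$ and $(T,\Pi[j'])\models\psi_1$ for all $0\le j'<j$; $(T,\Pi)\models\exists\pi.\varphi$ iff some $t\in T$ has $(T,\Pi[\pi\mapsto t])\models\varphi$; $(T,\Pi)\models\forall\pi.\varphi$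 iff all $t\in T$ do. A sentence has no free trace variables; $T\models\varphi$ means $(T,\Pi_\emptyset)\models\varphi$ for the empty assignment. For a set $T$ of traces, $\mathcal{M}(T)$ is the relational structure with domain $T\times\mathbb{N}$, $<$ interpreted as $\{((t,n),(t,n')) : t\in T,\ n<n'\}$, the binary equal-level relation $E$ interpreted as $\{((t,n),(t',n)) : t,t'\in T,\ n\in\mathbb{N}\}$, and for each $a\in AP$ a unary $P_a$ interpreted as $\{(t,n): a\in t(n)\}$. FO$[<,E]$ is first-order logic with equality over $\{<,E\}\cup\{P_a: a\in AP\}$. Abbreviations: $x\le y$ is $x<y\vee x=y$; $\mathrm{succ}(x,y)$ is $x<y\wedge\neg\exists z.\ x<z<y$; $\min(x)$ is $\neg\exists y.\ \mathrm{succ}(y,x)$; $\exists^M x.\ \varphi$ is $\exists x.\ \min(x)\wedge\varphi$ and $\forall^M x.\ \varphi$ is $\forall x.\ \min(x)\rightarrow\varphi$; $\exists^G y\ge x.\ \varphi$ is $\exists y.\ y\ge x\wedge\varphi$ and $\forall^G y\ge x.\ \varphi$ is $\forall y.\ y\ge x\rightarrow\varphi$. HyperFO is the set of FO$[<,E]$ sentences of the form $Q_1^M x_1.\cdots Q_k^M x_k.\ Q_1^G y_1\ge x_{g_1}.\cdots Q_\ell^G y_\ell\ge x_{g_\ell}.\ \psi$ with each $Q\in\{\exists,\forall\}$, where $\{x_1,\dots,x_k\}$ and $\{y_1,\dots,y_\ell\}$ are disjoint sets of variables, each guard $x_{g_j}\in\{x_1,\dots,x_k\}$, and $\psi$ is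 quantifier-free with free variables among $y_1,\dots,y_\ell$.
   Formalization: The set AP of atomic propositions is assumed nonempty: for empty AP there are no HyperLTL formulas at all, while HyperFO still has sentences such as ∃^M x. ∃^G y ≥ x. y = y, so the first half would fail. *)

(* Defs.v *)
From mathcomp Require Import all_boot.
From mathcomp Require Import boolp classical_sets.

Set Implicit Arguments.
Unset Strict Implicit.
Unset Printing Implicit Defensive.

Definition trace (AP : finType) := nat -> {set AP}.

Definition suffix (AP : finType) (j : nat) (t : trace AP) : trace AP :=
  fun n => t (j + n).

(* Trace variables of HyperLTL and first-order variables are both named by
   natural numbers. *)
Definition var := nat.

(* Assignments are partial: over an empty set of traces there is no total
   one, and sentences are evaluated under the empty assignment. *)
Definition assignment (D : Type) := var -> option D.

Definition empty_assignment (D : Type) : assignment D := fun=> None.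

Definition update (D : Type) (v : assignment D) (x : var) (d : D) :
  assignment D := fun y => if y == x then Some d else v y.

Variant quantifier := QEx | QAll.

Section HyperLTL.
Variable AP : finType.

Inductive ltl : Type :=
| LAtom of AP & var
| LNot of ltl
| LOr of ltl & ltl
| LNext of ltl
| LUntil of ltl & ltl.

Inductive hyperltl : Type :=
| HEx of var & hyperltl
| HAll of var & hyperltl
| HBody of ltl.

Fixpoint ltl_fv (psi : ltl) : seq var :=
  match psi with
  | LAtom _ p => [:: p]
  | LNot psi1 | LNext psi1 => ltl_fv psi1
  | LOr psi1 psi2 | LUntil psi1 psi2 => ltl_fv psi1 ++ ltl_fv psi2
  end.

Fixpoint hyperltl_fv (phi : hyperltl) : seq var :=
  match phi with
  | HEx p phi1 | HAll p phi1 => [seq q <- hyperltl_fv phi1 | q != p]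
  | HBody psi => ltl_fv psi
  end.

Definition hyperltl_sentence (phi : hyperltl) : Prop :=
  hyperltl_fv phi = [::].

Definition shift (j : nat) (Pi : assignment (trace AP)) :
  assignment (trace AP) := fun p => omap (suffix j) (Pi p).

(* The set of traces plays no role below the quantifier prefix. An atom whose
   trace variable is unassigned is false; this never occurs in a sentence. *)
Fixpoint ltl_sat (Pi : assignment (trace AP)) (psi : ltl) : Prop :=
  match psi with
  | LAtom a p => if Pi p is Some t then a \in t 0 else False
  | LNot psi1 => ~ ltl_sat Pi psi1
  | LOr psi1 psi2 => ltl_sat Pi psi1 \/ ltl_sat Pi psi2
  | LNext psi1 => ltl_sat (shift 1 Pi) psi1
  | LUntil psi1 psi2 =>
      exists2 j, ltl_sat (shift j Pi) psi2 &
        forall j', j' < j -> ltl_sat (shift j' Pi) psi1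
  end.

Fixpoint hyperltl_sat (T : set (trace AP)) (Pi : assignment (trace AP))
    (phi : hyperltl) : Prop :=
  match phi with
  | HEx p phi1 => exists2 t, T t & hyperltl_sat T (update Pi p t) phi1
  | HAll p phi1 => forall t, T t -> hyperltl_sat T (update Pi p t) phi1
  | HBody psi => ltl_sat Pi psi
  end.

Definition hyperltl_models (T : set (trace AP)) (phi : hyperltl) : Prop :=
  hyperltl_sat T (@empty_assignment _) phi.

End HyperLTL.

Section FirstOrder.
Variable AP : finType.

Inductive fo : Type :=
| FEq of var & var
| FLt of var & var
| FLevel of var & var
| FPred of AP & var
| FNot of fo
| FOr of fo & fo
| FAnd of fo & fo
| FImp of fo & fo
| FEx of var & fo
| FAll of var & fo.

Fixpoint fo_fv (phi : fo) : seq var :=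
  match phi with
  | FEq x y | FLt x y | FLevel x y => [:: x; y]
  | FPred _ x => [:: x]
  | FNot phi1 => fo_fv phi1
  | FOr phi1 phi2 | FAnd phi1 phi2 | FImp phi1 phi2 =>
      fo_fv phi1 ++ fo_fv phi2
  | FEx x phi1 | FAll x phi1 => [seq y <- fo_fv phi1 | y != x]
  end.

Definition fo_sentence (phi : fo) : Prop := fo_fv phi = [::].

Fixpoint fo_qfree (phi : fo) : bool :=
  match phi with
  | FEq _ _ | FLt _ _ | FLevel _ _ | FPred _ _ => true
  | FNot phi1 => fo_qfree phi1
  | FOr phi1 phi2 | FAnd phi1 phi2 | FImp phi1 phi2 =>
      fo_qfree phi1 && fo_qfree phi2
  | FEx _ _ | FAll _ _ => false
  end.

Record fo_structure : Type := FOStructure {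
  fo_domain :> Type;
  fo_lt : fo_domain -> fo_domain -> Prop;
  fo_level : fo_domain -> fo_domain -> Prop;
  fo_pred : AP -> fo_domain -> Prop }.

Definition holds2 (D : Type) (v : assignment D) (R : D -> D -> Prop)
    (x y : var) : Prop :=
  if (v x, v y) is (Some d, Some e) then R d e else False.

(* Atoms with an unassigned variable are false; this never occurs in a
   sentence. *)
Fixpoint fo_sat (M : fo_structure) (v : assignment M) (phi : fo) : Prop :=
  match phi with
  | FEq x y => holds2 v eq x y
  | FLt x y => holds2 v (@fo_lt M) x y
  | FLevel x y => holds2 v (@fo_level M) x y
  | FPred a x => if v x is Some d then fo_pred a d else False
  | FNot phi1 => ~ fo_sat v phi1
  | FOr phi1 phi2 => fo_sat v phi1 \/ fo_sat v phi2
  | FAnd phi1 phi2 => fo_sat v phi1 /\ fo_sat v phi2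
  | FImp phi1 phi2 => fo_sat v phi1 -> fo_sat v phi2
  | FEx x phi1 => exists d : M, fo_sat (update v x d) phi1
  | FAll x phi1 => forall d : M, fo_sat (update v x d) phi1
  end.

Definition fo_models (M : fo_structure) (phi : fo) : Prop :=
  fo_sat (@empty_assignment M) phi.

Definition trace_structure (T : set (trace AP)) : fo_structure :=
  @FOStructure (set_type T * nat)%type
    (fun d e => d.1 = e.1 /\ d.2 < e.2)
    (fun d e => d.2 = e.2)
    (fun a d => a \in (val d.1 : trace AP) d.2).

Definition FLe (x y : var) : fo := FOr (FLt x y) (FEq x y).

(* In FSucc and FMin the bound variable is chosen different from the
   arguments, which avoids capture. *)
Definition FSucc (x y : var) : fo :=
  let z := (maxn x y).+1 in
  FAnd (FLt x y) (FNot (FEx z (FAnd (FLt x z) (FLt z y)))).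

Definition FMin (x : var) : fo := let y := x.+1 in FNot (FEx y (FSucc y x)).

Definition FQuantM (Q : quantifier) (x : var) (phi : fo) : fo :=
  match Q with
  | QEx => FEx x (FAnd (FMin x) phi)
  | QAll => FAll x (FImp (FMin x) phi)
  end.

Definition FQuantG (Q : quantifier) (y x : var) (phi : fo) : fo :=
  match Q with
  | QEx => FEx y (FAnd (FLe x y) phi)
  | QAll => FAll y (FImp (FLe x y) phi)
  end.

Definition FPrefixM (qs : seq (quantifier * var)) (phi : fo) : fo :=
  foldr (fun q => FQuantM q.1 q.2) phi qs.

(* An entry (Q, y, x) stands for the quantifier Q^G y >= x with guard x. *)
Definition FPrefixG (qs : seq (quantifier * var * var)) (phi : fo) : fo :=
  foldr (fun q => FQuantG q.1.1 q.1.2 q.2) phi qs.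

Definition hyperfo (phi : fo) : Prop :=
  fo_sentence phi /\
  exists (qxs : seq (quantifier * var)) (qys : seq (quantifier * var * var))
         (psi : fo),
    let xs := [seq q.2 | q <- qxs] in
    let ys := [seq q.1.2 | q <- qys] in
    let guards := [seq q.2 | q <- qys] in
    [/\ ~~ has [in xs] ys,
        {subset guards <= xs},
        fo_qfree psi,
        {subset fo_fv psi <= ys} &
        phi = FPrefixM qxs (FPrefixG qys psi)].

End FirstOrder.

(* Main.v *)
(** From HyperFO to HyperLTL the trace quantifiers are kept, and the remaining
    guarded quantifiers form a first-order sentence over the single timeline
    carried by the selected traces: this is Kamp's theorem for future LTL at
    position 0. It is proved by quantifier elimination. A property of positions
    z1 <= .. <= zn is described by the products, in a finite aperiodic monoid, of
    LTL-definable labels over [0, z1), [z1, z2), .., together with an LTL property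
    of zn. Inserting a position between two others is handled by a
    Schutzenberger product. Inserting one after the last needs that LTL is closed
    under the existence of j >= i such that the labels over [i, j) multiply to m
    and F holds at j; this follows the local divisor technique of Diekert and Gastin,
    by induction on the size of the monoid and on the set of letters.

    From HyperLTL to HyperFO, an LTL formula is translated directly to prenex
    form; an atom on another trace is reached through the equal-level relation. *)
Require Import Defs.
From HB Require Import structures.
From mathcomp Require Import all_boot zify.
From mathcomp Require Import boolp.

Set Implicit Arguments.
Unset Strict Implicit.
Unset Printing Implicit Defensive.

(** * Aperiodic monoids *)

(** [iter n (op x) e] is the power x^n, so powers stabilize with one exponent for all elements. *)
Definition aperiodic (M : Type) (e : M) (op : M -> M -> M) : Prop :=
  exists n, forall x, iter n.+1 (op x) e = iter n (op x) e.

(* The set [c * M :&: M * c] with the product [(x * c) o (c * y) = x * c * y] and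
   the unit [c]. *)
Section LocalDivisor.
Variables (M : finType) (e : M) (op : Monoid.law e) (c : M).
Local Infix "*" := op.

Let mulA : associative op := @Monoid.mulmA _ op.

Record local_divisor := LocalDivisor {
  ld_val :> M;
  _ : [exists y, ld_val == c * y] && [exists z, ld_val == z * c] }.

HB.instance Definition _ := [isSub for ld_val].
HB.instance Definition _ := [Finite of local_divisor by <:].

Lemma ldPl (x : local_divisor) : exists y, ld_val x = c * y.
Proof. by case: x => x /= /andP[/existsP[y /eqP ->] _]; exists y. Qed.

Lemma ldPr (x : local_divisor) : exists z, ld_val x = z * c.
Proof. by case: x => x /= /andP[_ /existsP[y /eqP ->]]; exists y. Qed.

(** The default [e] is never reached, by [ldPl]. The choice among several left quotients by [c] is
    harmless, as [ld_mulE] shows. *)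
Definition ld_tail (x : local_divisor) : M :=
  odflt e [pick y | ld_val x == c * y].

Lemma ld_tailE (x : local_divisor) : c * ld_tail x = x.
Proof.
rewrite /ld_tail; case: pickP => [y /eqP -> //|no].
by have [y /eqP] := ldPl x; rewrite no.
Qed.

Fact ld_one_subproof : [exists y, c == c * y] && [exists z, c == z * c].
Proof. by apply/andP; split; apply/existsP; exists e; rewrite ?Monoid.simpm. Qed.

Definition ld_one : local_divisor := LocalDivisor ld_one_subproof.

Fact ld_mul_subproof (x y : local_divisor) :
  [exists z, x * ld_tail y == c * z] && [exists z, x * ld_tail y == z * c].
Proof.
apply/andP; split; apply/existsP.
  have [x' ->] := ldPl x; exists (x' * ld_tail y).
  by rewrite mulA.
have [x' ->] := ldPr x; have [y' Ey] := ldPr y; exists (x' * y').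
by rewrite -!mulA ld_tailE Ey.
Qed.

Definition ld_mul (x y : local_divisor) : local_divisor :=
  LocalDivisor (ld_mul_subproof x y).

(** Since x = x' * c, the product x * t = x' * (c * t) = x' * y depends on [y] only. *)
Lemma ld_mulE (x y : local_divisor) (t : M) :
  ld_val y = c * t -> ld_val (ld_mul x y) = x * t.
Proof.
move=> Ey /=; have [x' ->] := ldPr x.
by rewrite -!mulA ld_tailE Ey.
Qed.

Fact ld_mulA : associative ld_mul.
Proof.
move=> x y z; apply: val_inj.
have [z' Ez] := ldPl z; have [y' Ey] := ldPl y.
have Eyz : ld_val (ld_mul y z) = c * (y' * z').
  by rewrite (ld_mulE _ Ez) Ey mulA.
by rewrite [LHS](ld_mulE _ Eyz) [RHS](ld_mulE _ Ez) (ld_mulE _ Ey) mulA.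
Qed.

Fact ld_mul1m : left_id ld_one ld_mul.
Proof. by move=> x; apply: val_inj; rewrite /= ld_tailE. Qed.

Fact ld_mulm1 : right_id ld_one ld_mul.
Proof.
move=> x; apply: val_inj.
by rewrite [LHS](@ld_mulE _ _ e) /= ?Monoid.mulm1.
Qed.

HB.instance Definition _ :=
  Monoid.isLaw.Build local_divisor ld_one ld_mul ld_mulA ld_mul1m ld_mulm1.

(** If x = c * y, the k-th local power of [x] is c * y^k. *)
Lemma ld_aperiodic : aperiodic e op -> aperiodic ld_one ld_mul.
Proof.
move=> [n apM]; exists n => x; have [y Ex] := ldPl x.
have pow k : ld_val (iter k (ld_mul x) ld_one) = c * iter k (op y) e.
  elim: k => [|k IHk]; first by rewrite /= Monoid.mulm1.
  by rewrite iterS (ld_mulE _ IHk) Ex iterS mulA.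
by apply: val_inj; rewrite [LHS](pow n.+1) apM [RHS](pow n).
Qed.

(** The unit [e] lies outside the local divisor: if e = c * y, then c^k * y^k = e for all k, and
    multiplying the case k = n by [c] gives c = e because c^(n+1) = c^n. *)
Lemma card_local_divisor :
  aperiodic e op -> c != e -> #|{: local_divisor}| < #|M|.
Proof.
move=> [n apM] ce; rewrite card_sub.
apply/proper_card/properP; split; first exact: subset_predT.
exists e => //; apply: contra ce => /andP[/existsP[y /eqP Ey] _].
have pow k : iter k (op c) e * iter k (op y) e = e.
  elim: k => [|k IHk]; first by rewrite /= Monoid.mulm1.
  have -> : iter k.+1 (op c) e = iter k (op c) e * c.
    elim: k {IHk} => [|k IHk]; first by rewrite iterS Monoid.mulm1 Monoid.mul1m.
    by rewrite iterS [in LHS]IHk mulA.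
  by rewrite iterS -mulA (mulA c) -Ey Monoid.mul1m.
have : c * (iter n (op c) e * iter n (op y) e) = iter n (op c) e * iter n (op y) e.
  by rewrite mulA -iterS apM.
by rewrite pow Monoid.mulm1 => /eqP.
Qed.

End LocalDivisor.

Lemma aperiodic_eq (M : Type) (e : M) (op : M -> M -> M) n k l x :
  (forall y, iter n.+1 (op y) e = iter n (op y) e) -> n <= k -> n <= l ->
  iter k (op x) e = iter l (op x) e.
Proof.
move=> apM; suff stab m : n <= m -> iter m (op x) e = iter n (op x) e.
  by move=> nk nl; rewrite !stab.
by move=> /subnK <-; elim: (m - n) => // d IHd; rewrite addSn iterS IHd; exact: apM.
Qed.

(** * Direct products of aperiodic monoids *)

Section Product.
Variables (M1 M2 : finType) (e1 : M1) (e2 : M2).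
Variables (op1 : Monoid.law e1) (op2 : Monoid.law e2).

Definition prod_mul (x y : M1 * M2) : M1 * M2 := (op1 x.1 y.1, op2 x.2 y.2).

Fact prod_mulA : associative prod_mul.
Proof. by move=> x y z; rewrite /prod_mul /= !Monoid.mulmA. Qed.

Fact prod_mul1m : left_id (e1, e2) prod_mul.
Proof. by case=> x y; rewrite /prod_mul /= !Monoid.mul1m. Qed.

Fact prod_mulm1 : right_id (e1, e2) prod_mul.
Proof. by case=> x y; rewrite /prod_mul /= !Monoid.mulm1. Qed.

HB.instance Definition _ :=
  Monoid.isLaw.Build (M1 * M2)%type (e1, e2) prod_mul
    prod_mulA prod_mul1m prod_mulm1.

Lemma prod_aperiodic :
  aperiodic e1 op1 -> aperiodic e2 op2 -> aperiodic (e1, e2) prod_mul.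
Proof.
move=> [n1 ap1] [n2 ap2]; exists (maxn n1 n2) => x.
have pow k : iter k (prod_mul x) (e1, e2) =
             (iter k (op1 x.1) e1, iter k (op2 x.2) e2).
  by elim: k => //= k ->.
rewrite !pow; congr (_, _).
  by apply: (aperiodic_eq _ ap1); rewrite ?leqW // leq_maxl.
by apply: (aperiodic_eq _ ap2); rewrite ?leqW // leq_maxr.
Qed.

End Product.

(** With labels of the form [Some], the product over an interval is the label of its first position,
    or [None] if the interval is empty. This monoid reads off single labels and tests intervals for
    emptiness. *)
Definition first_some (T : Type) (x y : option T) : option T :=
  if x is Some _ then x else y.

Fact first_someA T : associative (@first_some T).
Proof. by case. Qed.

Fact first_some1m T : left_id None (@first_some T).
Proof. by []. Qed.

Fact first_somem1 T : right_id None (@first_some T).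
Proof. by case. Qed.

HB.instance Definition _ T :=
  Monoid.isLaw.Build (option T) None (@first_some T)
    (@first_someA T) (@first_some1m T) (@first_somem1 T).

Lemma first_some_aperiodic T : aperiodic None (@first_some T).
Proof. by exists 1; case. Qed.

(* The second component of a product over an interval collects the pairs of
   values of the two parts over all ways to cut the interval. *)
Section Schutzenberger.
Variables (M : finType) (e : M) (op : Monoid.law e).
Local Infix "*" := op.
Local Notation S := (M * {set M * M})%type.

Let mulA : associative op := @Monoid.mulmA _ op.

Definition sch_one : S := (e, set0).

Definition sch_mul (x y : S) : S :=
  (x.1 * y.1, [set (x.1 * p.1, p.2) | p in y.2] :|:
              [set (p.1, p.2 * y.1) | p in x.2])%SET.

Lemma sch_mulP (x y : S) a b :
  reflect ((exists2 a', a = x.1 * a' & (a', b) \in y.2) \/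
           (exists2 b', b = b' * y.1 & (a, b') \in x.2))
          ((a, b) \in (sch_mul x y).2).
Proof.
apply: (iffP setUP).
  case=> /imsetP[[a' b'] in_ [-> ->]]; [left; exists a'|right; exists b'] => //.
case=> [[a' -> ya]|[b' -> xb]]; [left|right]; apply/imsetP.
  by exists (a', b).
by exists (a, b').
Qed.

Fact sch_mulA : associative sch_mul.
Proof.
move=> x y z; congr (_, _); first exact: mulA.
apply/setP => -[a b]; apply/sch_mulP/sch_mulP.
  case=> [[a' -> /sch_mulP[[a2 -> za]|[b' -> yb]]]|[b' -> xb]].
  - by left; exists a2; rewrite //= mulA.
  - by right; exists b' => //; apply/sch_mulP; left; exists a'.
  - right; exists (b' * y.1); first by rewrite /= mulA.
    by apply/sch_mulP; right; exists b'.
case=> [[a' -> za]|[b' -> /sch_mulP[[a' -> ya]|[b2 -> xb]]]].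
- left; exists (y.1 * a'); first by rewrite /= mulA.
  by apply/sch_mulP; left; exists a'.
- by left; exists a' => //; apply/sch_mulP; right; exists b'.
- by right; exists b2; rewrite //= mulA.
Qed.

Fact sch_mul1m : left_id sch_one sch_mul.
Proof.
move=> [m P]; congr (_, _); first exact: Monoid.mul1m.
apply/setP => -[a b]; apply/sch_mulP/idP.
  by case=> [[a' /= ->]|[b' _]]; rewrite ?Monoid.mul1m // inE.
by move=> Pab; left; exists a => //=; rewrite Monoid.mul1m.
Qed.

Fact sch_mulm1 : right_id sch_one sch_mul.
Proof.
move=> [m P]; congr (_, _); first exact: Monoid.mulm1.
apply/setP => -[a b]; apply/sch_mulP/idP.
  by case=> [[a' _]|[b' /= ->]]; rewrite ?Monoid.mulm1 // inE.
by move=> Pab; right; exists b => //=; rewrite Monoid.mulm1.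
Qed.

HB.instance Definition _ :=
  Monoid.isLaw.Build S sch_one sch_mul sch_mulA sch_mul1m sch_mulm1.

(** A pair in the k-th power arises by cutting inside one of the k factors, with i factors before it
    and j after, and equals (m^i * p.1, p.2 * m^j). For large k one of i and j can change by one
    without changing its power of m. *)
Lemma sch_aperiodic : aperiodic e op -> aperiodic sch_one sch_mul.
Proof.
move=> [n apM]; exists (n + n).+1 => -[m P].
have pow1 k : (iter k (sch_mul (m, P)) sch_one).1 = iter k (op m) e.
  by elim: k => //= k ->.
have pow2 k a b : (a, b) \in (iter k (sch_mul (m, P)) sch_one).2 <->
    exists i j p, [/\ i + j.+1 = k, a = iter i (op m) p.1,
                      b = p.2 * iter j (op m) e & p \in P].
  elim: k a b => [|k IHk] a b.
    split=> [|[i [j [p []]]]]; first by rewrite inE.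
    by rewrite addnS.
  split=> [/sch_mulP[[a' -> /IHk[i [j [p [Ek -> -> Pp]]]]]|[b' -> Pb]]|].
  - by exists i.+1, j, p; rewrite addSn Ek.
  - by exists 0, k, (a, b'); rewrite pow1.
  move=> [[|i] [j [p [Ek -> -> Pp]]]]; apply/sch_mulP; [right|left].
    exists p.2; last by rewrite -surjective_pairing.
    by move: Ek => [->]; rewrite pow1.
  exists (iter i (op m) p.1) => //; apply/IHk; exists i, j, p; split=> //.
  by move: Ek; rewrite addSn => -[].
have iterop i x : iter i (op m) x = iter i (op m) e * x.
  by elim: i => [|i IHi]; rewrite ?Monoid.mul1m // !iterS IHi mulA.
have pow_eq i j x : n <= i -> n <= j -> iter i (op x) e = iter j (op x) e.
  exact: aperiodic_eq.
rewrite [LHS]surjective_pairing [RHS]surjective_pairing; congr (_, _).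
  by rewrite !pow1; apply: pow_eq; rewrite ?leqW // leq_addr.
(* The exponent 2n+1 is chosen for this count: i + j = 2n+1 forces i > n or j > n, so one of them
   may drop; i + j = 2n forces i >= n or j >= n, so one may grow. *)
apply/setP => -[a b]; apply/idP/idP => /pow2[i [j [p [Ek -> -> Pp]]]]; apply/pow2.
  have [ni|ni] := ltnP n i.
    exists i.-1, j, p; case: i ni Ek => // i ni; rewrite addSn => -[Ek].
    split=> //; rewrite iterop [RHS]iterop; congr (op _ _).
    by apply: pow_eq; rewrite // leqW.
  have nj : n < j by lia.
  exists i, j.-1, p; case: j nj Ek => // j nj; rewrite addnS => -[Ek].
  by split=> //; congr (op _ _); apply: pow_eq; rewrite // leqW.
have [ni|ni] := leqP n i.
  exists i.+1, j, p; rewrite addSn Ek; split=> //.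
  by rewrite iterop [RHS]iterop; congr (op _ _); apply: pow_eq; rewrite // leqW.
have nj : n <= j by lia.
exists i, j.+1, p; rewrite addnS Ek; split=> //.
by congr (op _ _); apply: pow_eq; rewrite // leqW.
Qed.

End Schutzenberger.

(** * Temporal classes and local divisors *)

Section Factor.
Variables (M : finType) (e : M) (op : Monoid.law e).
Implicit Types (lam : nat -> M) (Q F : nat -> Prop).

Definition iprod lam (i j : nat) : M := \big[op/e]_(i <= k < j) lam k.

(** An until operator that also prescribes the product of the labels passed. The guard [Q] serves to
    restrict which letters may occur, as the induction on the set of letters requires. *)
Definition factor lam Q (m : M) F (i : nat) : Prop :=
  exists j, [/\ i <= j, forall k, i <= k < j -> Q k, iprod lam i j = m & F j].

Lemma iprod_nil lam i : iprod lam i i = e.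
Proof. by rewrite /iprod big_geq. Qed.

Lemma iprod_cons lam i j : i < j -> iprod lam i j = op (lam i) (iprod lam i.+1 j).
Proof. by move=> ij; rewrite /iprod big_ltn. Qed.

Lemma iprod_cat lam i k j :
  i <= k -> k <= j -> iprod lam i j = op (iprod lam i k) (iprod lam k j).
Proof. by move=> ik kj; rewrite /iprod (big_cat_nat ik kj). Qed.

Lemma iprod_one lam i j :
  (forall k, i <= k < j -> lam k = e) -> iprod lam i j = e.
Proof. by move=> lam1; rewrite /iprod big_nat big1. Qed.

End Factor.

(** * Cutting at a letter [c] and passing to its local divisor *)

Section Blocks.
Variables (M : finType) (e : M) (op : Monoid.law e) (c : M).
Variables (lam : nat -> M) (Q : nat -> Prop).
Local Infix "*" := op.
Local Notation D := (local_divisor op c).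

Let mulA : associative op := @Monoid.mulmA _ op.

Let Qc k := Q k /\ lam k <> c.
Let C k := lam k = c.

Fact ld_block_subproof u :
  [exists y, c * u * c == c * y] && [exists z, c * u * c == z * c].
Proof.
apply/andP; split; apply/existsP; last by exists (c * u).
by exists (u * c); rewrite mulA.
Qed.

Definition ld_block u : D := LocalDivisor (ld_block_subproof u).

(* At an occurrence of [c] whose next block, up to the following [c], multiplies to
   [u], the label is [c * u * c]; elsewhere it is the unit. Hence the labels from
   one [c] to another multiply, in the local divisor, to the product of the letters
   between them, both ends included. *)
Definition block_label (i : nat) : D :=
  if lam i == c then
    odflt (ld_one op c)
      (omap ld_block [pick u | `[< factor op lam Qc u C i.+1 >]])
  else ld_one op c.

(** The guard [Qc] excludes [c] before the end of the block, so both witnesses are the next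
    occurrence of [c]. This makes the choice in [block_label] unambiguous. *)
Lemma factor_block_inj u u' i :
  factor op lam Qc u C i -> factor op lam Qc u' C i -> u = u'.
Proof.
move=> [j [ij Qj <- Cj]] [j' [ij' Qj' <- Cj']].
have [jj'|j'j|-> //] := ltngtP j j'.
  by have [] := Qj' j; rewrite ?ij ?jj'.
by have [] := Qj j'; rewrite ?ij' ?j'j.
Qed.

Lemma block_labelE u i : lam i = c -> factor op lam Qc u C i.+1 ->
  block_label i = ld_block u.
Proof.
move=> lami fu; rewrite /block_label lami eqxx.
case: pickP => [u' /asboolP fu' /=|/(_ u) /asboolP//].
by rewrite (factor_block_inj fu fu').
Qed.

(** Induction on the length. The first block ends at the next [c], at position [p]; the labels
    strictly in between are units, and the local product merges the two copies of [c] at [p]. The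
    letter at [j] is counted on the right because the last block label already ends with it. *)
Lemma iprod_block_label i j : i <= j -> lam i = c -> lam j = c ->
  (forall k, i <= k < j -> Q k) ->
  ld_val (iprod (ld_mul (op:=op) (c:=c)) block_label i j) = iprod op lam i j.+1.
Proof.
have [n] := ubnP (j - i); elim: n i => // n IHn i ltn ij lami lamj Qij.
move: ij; rewrite leq_eqVlt => /predU1P[Eij|ij].
  by rewrite -Eij iprod_nil iprod_cons // iprod_nil Monoid.mulm1 lami.
have exc : exists k, (i < k) && (lam k == c) by exists j; rewrite ij lamj eqxx.
case: (ex_minnP exc) => p /andP[ip /eqP lamp] minp.
have pj : p <= j by apply: minp; rewrite ij lamj eqxx.
have not_c k : i < k < p -> lam k <> c.
  by move=> /andP[ik kp] /eqP lamk; move: kp; rewrite ltnNge minp // ik.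
have fu : factor op lam Qc (iprod op lam i.+1 p) C i.+1.
  exists p; split=> // k /andP[ik kp]; split; last by apply: not_c; rewrite ik.
  by apply: Qij; rewrite (ltnW ik) (leq_trans kp).
rewrite iprod_cons // (iprod_cat _ _ ip pj) (iprod_one _ (i := i.+1)); last first.
  move=> k /andP[ik kp]; rewrite /block_label ifN //; apply/eqP/not_c.
  by rewrite ik.
rewrite Monoid.mul1m (block_labelE lami fu).
have Ep : ld_val (iprod (ld_mul (op:=op) (c:=c)) block_label p j) =
          c * iprod op lam p.+1 j.+1.
  rewrite IHn //.
  - by rewrite iprod_cons ?ltnS // lamp.
  - by rewrite (leq_trans (ltn_sub2l ij ip)).
  - by move=> k /andP[pk kj]; apply: Qij; rewrite kj (leq_trans (ltnW ip)).
rewrite [LHS](ld_mulE _ Ep) /= (iprod_cons _ _ (leqW ij)) lami.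
rewrite (iprod_cat _ _ ip (leqW pj)) (@iprod_cons _ _ _ _ p) ?ltnS // lamp.
by rewrite !mulA.
Qed.

(* An interval containing [c] is cut at its first and its last [c]. *)
Lemma factor_split m F i :
  factor op lam Q m F i <->
  factor op lam Qc m F i \/
  exists m0 (d : D) m2, m0 * (d * m2) = m /\
    factor op lam Qc m0 (fun p => C p /\
      factor (ld_mul (op:=op) (c:=c)) block_label Q d (fun q =>
        [/\ C q, Q q & factor op lam Qc m2 F q.+1]) p) i.
Proof.
split=> [[j [ij Qij Em Fj]]|].
  have [exc|noc] := pselect (exists k, (i <= k < j) && (lam k == c)); last first.
    left; exists j; split=> // k kij; split; first exact: Qij.
    by move=> /eqP lamk; apply: noc; exists k; rewrite kij.
  have bnd k : (i <= k < j) && (lam k == c) -> k <= j.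
    by case/andP=> /andP[_ /ltnW].
  right; case: (ex_minnP exc) => p /andP[/andP[ip pj] /eqP lamp] minp.
  case: (ex_maxnP exc bnd) => q /andP[/andP[iq qj] /eqP lamq] maxq.
  have pq : p <= q by apply: minp; rewrite iq qj lamq eqxx.
  exists (iprod op lam i p).
  exists (iprod (ld_mul (op:=op) (c:=c)) block_label p q), (iprod op lam q.+1 j).
  split.
    rewrite iprod_block_label //; last first.
      by move=> k /andP[pk kq]; apply: Qij; rewrite (leq_trans ip) // (ltn_trans kq).
    by rewrite -iprod_cat ?(leqW pq) // -iprod_cat // (leq_trans pq) // ltnW.
  exists p; split=> //.
    move=> k /andP[ik kp]; split; first by apply: Qij; rewrite ik (ltn_trans kp).
    move=> /eqP lamk; have: p <= k by apply: minp; rewrite ik (ltn_trans kp).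
    by rewrite leqNgt kp.
  split=> //; exists q; split=> //.
    by move=> k /andP[pk kq]; apply: Qij; rewrite (leq_trans ip) // (ltn_trans kq).
  (* The middle factor guards positions below [q] only and the last one starts at [q.+1], hence the
     separate conjunct [Q q]. *)
  split=> //; first by apply: Qij; rewrite iq.
  exists j; split=> // k /andP[qk kj]; have ik := leq_trans iq (ltnW qk).
  split; first by apply: Qij; rewrite ik.
  by move=> /eqP lamk; move: qk; rewrite ltnNge maxq // ik kj.
case=> [[j [ij Qij Em Fj]]|].
  by exists j; split=> // k /Qij[].
move=> [m0 [d [m2 [Em [p [ip Qip Em0 [lamp]]]]]]].
move=> [q [pq Qpq Ed [lamq Qq [j [qj Qqj Em2 Fj]]]]].
exists j; split=> //.
- by rewrite (leq_trans ip) // (leq_trans pq) // ltnW.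
- move=> k /andP[ik kj].
  have [kp|pk] := ltnP k p; first by have [] := Qip k; rewrite ?ik.
  have [kq|] := ltnP k q; first by apply: Qpq; rewrite pk.
  rewrite leq_eqVlt => /predU1P[<- //|qk].
  by have [] := Qqj k; rewrite ?qk.
rewrite (iprod_cat _ _ ip) ?(leq_trans pq) 1?ltnW // Em0 -Em.
by rewrite (iprod_cat _ _ (leqW pq) qj) Em2 -iprod_block_label // Ed.
Qed.

End Blocks.

(** The properties of a position in a model [w] that LTL can express, abstracted from syntax; [W]
    will be the type of families of traces. The closure conditions are the LTL operators, with until
    in absolute positions. *)
Record temporal_class (W : Type) (L : (W -> nat -> Prop) -> Prop) : Prop :=
  TemporalClass {
    tc_ext : forall P P', (forall w i, P w i <-> P' w i) -> L P -> L P';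
    tc_true : L (fun _ _ => True);
    tc_not : forall P, L P -> L (fun w i => ~ P w i);
    tc_or : forall P P', L P -> L P' -> L (fun w i => P w i \/ P' w i);
    tc_next : forall P, L P -> L (fun w i => P w i.+1);
    tc_until : forall P P', L P -> L P' -> L (fun w i =>
      exists j, [/\ i <= j, forall k, i <= k < j -> P w k & P' w j]) }.

Section TemporalClass.
Variables (W : Type) (L : (W -> nat -> Prop) -> Prop).
Hypothesis tcL : temporal_class L.

(** Classically [A] is true or false, and both constants are in [L]. *)
Lemma tc_const (A : Prop) : L (fun _ _ => A).
Proof.
have [hA|hA] := pselect A; first by apply: tc_ext (tc_true tcL).
by apply: tc_ext (tc_not tcL (tc_true tcL)) => // w i; split=> // /(_ I).
Qed.

Lemma tc_and P P' : L P -> L P' -> L (fun w i => P w i /\ P' w i).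
Proof.
move=> LP LP'.
apply: tc_ext (tc_not tcL (tc_or tcL (tc_not tcL LP) (tc_not tcL LP'))) => // w i.
by rewrite not_orE !notE.
Qed.

Lemma tc_exists (I : finType) (P : I -> W -> nat -> Prop) :
  (forall x, L (P x)) -> L (fun w i => exists x, P x w i).
Proof.
move=> LP; have Ls (s : seq I) : L (fun w i => exists2 x, x \in s & P x w i).
  elim: s => [|x s IHs].
    by apply: tc_ext (tc_const False) => // w i; split=> // -[].
  apply: tc_ext (tc_or tcL (LP x) IHs) => // w i; split.
    case=> [Px|[y sy Py]]; first by exists x; rewrite ?mem_head.
    by exists y; rewrite // inE sy orbT.
  case=> y; rewrite inE => /predU1P[->|sy] Py; [by left|right].
  by exists y.
apply: tc_ext (Ls (enum I)) => // w i; split=> [[x _ Px]|[x Px]]; exists x => //.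
by rewrite mem_enum.
Qed.

Definition definable (M : finType) (lam : W -> nat -> M) : Prop :=
  forall m, L (fun w i => lam w i = m).

(** * The induction step of the local divisor technique *)

Section LocalStep.
Variables (M : finType) (e : M) (op : Monoid.law e) (c : M).
Variables (lam : W -> nat -> M) (Q : W -> nat -> Prop).
Hypotheses (Llam : definable lam) (LQ : L Q).

Let Qc w i := Q w i /\ lam w i <> c.

Hypothesis tc_factor_nc : forall m F, L F ->
  L (fun w => factor op (lam w) (Qc w) m (F w)).

(** That the block after an occurrence of [c] multiplies to [u] is a next followed by a factor
    without [c], which is in [L]. The remaining positions carry the unit. *)
Lemma definable_block_label :
  definable (fun w => block_label op c (lam w) (Q w)).
Proof.
move=> d.
pose B u w i := lam w i = c /\
  factor op (lam w) (Qc w) u (fun k => lam w k = c) i.+1.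
have LB u : L (B u).
  by apply: tc_and; [exact: Llam|exact: (tc_next tcL (tc_factor_nc u (Llam c)))].
have Lhit : L (fun w i => exists u, B u w i /\ ld_block op c u = d).
  by apply: tc_exists => u; apply: tc_and; [exact: LB|exact: tc_const].
have Lmiss : L (fun w i => ~ (exists u, B u w i) /\ ld_one op c = d).
  exact: tc_and (tc_not tcL (tc_exists LB)) (tc_const _).
apply: tc_ext (tc_or tcL Lhit Lmiss) => // w i; split.
  case=> [[u [[lamc fu] <-]]|[nB <-]]; first exact: block_labelE.
  rewrite /block_label; case: eqP => // lamc.
  case: pickP => //= u /asboolP fu; by case: nB; exists u.
move=> Ed; have [[u Bu]|nB] := pselect (exists u, B u w i); [left|right].
  by exists u; split=> //; rewrite -Ed; case: Bu => lamc fu; rewrite (block_labelE lamc fu).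
split=> //; rewrite -Ed /block_label; case: eqP => // lamc.
by case: pickP => //= u /asboolP fu; case: nB; exists u.
Qed.

Hypothesis tc_factor_ld : forall d F, L F ->
  L (fun w => factor (ld_mul (op := op) (c := c))
                (block_label op c (lam w) (Q w)) (Q w) d (F w)).

(** [factor_split] turns the property into a finite disjunction over [m0], [d] and [m2] of nested
    factors: the outer ones avoid [c], the middle one is over the local divisor. *)
Lemma tc_factor_step m F : L F -> L (fun w => factor op (lam w) (Q w) m (F w)).
Proof.
move=> LF.
have Lc : L (fun w i => lam w i = c) by exact: Llam.
pose G m0 (d : local_divisor op c) m2 w := factor op (lam w) (Qc w) m0 (fun p =>
  lam w p = c /\ factor (ld_mul (op:=op) (c:=c)) (block_label op c (lam w) (Q w))
    (Q w) d (fun q =>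
      [/\ lam w q = c, Q w q & factor op (lam w) (Qc w) m2 (F w) q.+1]) p).
have LG m0 d m2 : L (G m0 d m2).
  apply: tc_factor_nc; apply: (tc_and Lc); apply: tc_factor_ld.
  have LF2 := tc_next tcL (tc_factor_nc m2 LF).
  by apply: tc_ext (tc_and Lc (tc_and LQ LF2)) => // w i; split=> [[? []]|[]].
have Lex : L (fun w i => exists x : M * local_divisor op c * M,
    op x.1.1 (op x.1.2 x.2) = m /\ G x.1.1 x.1.2 x.2 w i).
  by apply: tc_exists => x; apply: tc_and => //; exact: tc_const.
apply: tc_ext (tc_or tcL (tc_factor_nc m LF) Lex) => // w i.
apply: iff_trans (iff_sym (factor_split op c _ _ _ _ _)).
split=> -[?|H]; [by left| |by left|]; right.
  by case: H => [[[m0 d] m2] [Em fG]]; exists m0, d, m2.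
by case: H => [m0 [d [m2 [Em fG]]]]; exists (m0, d, m2).
Qed.

End LocalStep.

(** The outer induction is on the size of [M], the inner one on the set of non-unit letters. A
    non-unit letter [c] is either removed from the letters or used to pass to its local divisor,
    which is smaller than [M]. *)
Lemma tc_factor (M : finType) (e : M) (op : Monoid.law e) lam m Q F :
  aperiodic e op -> definable lam -> L Q -> L F ->
  L (fun w => factor op (lam w) (Q w) m (F w)).
Proof.
have [n] := ubnP #|M|; elim: n M e op lam m Q F => // n IHn M e op.
move=> lam m Q F leMn apM Llam.
have [k] := ubnP #|M|.
(* The set [A] bounds the non-unit labels at positions satisfying [Q]; initially it is all of
   [M]. *)
have: forall w i, Q w i -> lam w i != e -> lam w i \in [set: M] by [].
rewrite -cardsT; move: [set: M] => A.
elim: k A m Q F => // k IHk A m Q F QA ltAk LQ LF.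
(* Without non-unit letters every product is [e], and the factor is a plain until. *)
have [[c Ac ce]|none] := pselect (exists2 c, c \in A & c != e); last first.
  have lam1 w i : Q w i -> lam w i = e.
    move=> Qi; apply/eqP/negPn/negP => lame.
    by apply: none; exists (lam w i) => //; exact: QA.
  apply: tc_ext (tc_and (tc_const (m = e)) (tc_until tcL LQ LF)) => // w i; split.
    move=> [-> [j [ij Qij Fj]]]; exists j; split=> //.
    by apply: iprod_one => l /Qij/lam1.
  move=> [j [ij Qij <- Fj]]; split; last by exists j.
  by apply: iprod_one => l /Qij/lam1.
have nc m' G : L G ->
    L (fun w => factor op (lam w) (fun i => Q w i /\ lam w i <> c) m' (G w)).
  move=> LG; apply: (IHk (A :\ c)) => //.
  - by move=> w i [Qi /eqP lamc] lame; rewrite !inE lamc QA.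
  - by move: ltAk; rewrite (cardsD1 c) Ac.
  - exact: tc_and LQ (tc_not tcL (Llam c)).
apply: (tc_factor_step (c := c)) => // d G LG.
apply: IHn => //.
- by rewrite (leq_trans (card_local_divisor apM ce)) // -ltnS.
- exact: ld_aperiodic.
- exact: definable_block_label.
Qed.

End TemporalClass.

(** * Elimination of first-order quantifiers *)

Lemma iprod_morph (M M' : finType) (e : M) (e' : M') (op : Monoid.law e)
    (op' : Monoid.law e') (h : M -> M') (lam : nat -> M) (lam' : nat -> M') i j :
  h e = e' -> {morph h : x y / op x y >-> op' x y} -> (forall k, h (lam k) = lam' k) ->
  h (iprod op lam i j) = iprod op' lam' i j.
Proof.
move=> he hM hlam; rewrite /iprod (big_morph h hM he).
by apply: eq_bigr => k _; exact: hlam.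
Qed.

Lemma map_pairmap (T1 T2 T3 : Type) (h : T2 -> T3) (f : T1 -> T1 -> T2) x s :
  map h (pairmap f x s) = pairmap (fun a b => h (f a b)) x s.
Proof. by elim: s x => //= y s IHs x; rewrite IHs. Qed.

Lemma path_leq_mem a s b : path leq a s -> b \in s -> a <= b.
Proof. by move=> /(order_path_min leq_trans)/allP; exact. Qed.

Lemma path_leq_last a s : path leq a s -> a <= last a s.
Proof.
case: s => // b s ps; apply: (path_leq_mem ps); exact: mem_last.
Qed.

Lemma drop_pairmap (T T' : Type) (f : T -> T -> T') a s b t n : size s = n ->
  drop n.+1 (pairmap f a (s ++ b :: t)) = pairmap f b t.
Proof.
move=> <-; rewrite pairmap_cat /= -cat_rcons drop_size_cat //.
by rewrite size_rcons size_pairmap.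
Qed.

Lemma iprod_pairmap (M : finType) (e : M) (op : Monoid.law e) lam a s :
  path leq a s ->
  \big[op/e]_(m <- pairmap (iprod op lam) a s) m = iprod op lam a (last a s).
Proof.
elim: s a => [|b s IHs] a /=; first by rewrite big_nil iprod_nil.
move=> /andP[ab pbs]; rewrite big_cons IHs // -iprod_cat //.
exact: path_leq_last.
Qed.

Lemma iprod_first_some (T : finType) (lam : nat -> T) i j : i <= j ->
  iprod (@first_some T) (fun k => Some (lam k)) i j =
  if i == j then None else Some (lam i).
Proof.
rewrite leq_eqVlt; case: eqP => [-> _|_ /= ij]; first by rewrite iprod_nil.
by rewrite iprod_cons.
Qed.

Lemma path_leq_insert d a s : path leq a s -> a <= d ->
  exists2 k, k <= size s & path leq a (take k s ++ d :: drop k s).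
Proof.
elim: s a => [|b s IHs] a /=; first by move=> _ ad; exists 0; rewrite //= ad.
move=> /andP[ab ps] ad; have [db|/ltnW bd] := leqP d b.
  by exists 0; rewrite //= ad db.
by have [k ks pk] := IHs b ps bd; exists k.+1; rewrite //= ab.
Qed.

(** The label at [k] contributes the cut just before [k], so the second component collects the cuts
    [z] with i <= z < j; the cut at the right end [j] is absent. *)
Lemma sch_iprod (M : finType) (e : M) (op : Monoid.law e) (lam : nat -> M) i j :
  let S := iprod (sch_mul op) (fun k => (lam k, [set (e, lam k)])) i j in
  i <= j -> S.1 = iprod op lam i j /\
    forall p q, (p, q) \in S.2 <->
      exists z, [/\ i <= z, z < j, p = iprod op lam i z & q = iprod op lam z j].
Proof.
move=> /= /subnK <-; move: (j - i) => {j} d; elim: d i => [|d IHd] i.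
  rewrite add0n !iprod_nil /=; split=> // p q; split; first by rewrite inE.
  by move=> [z [iz]]; rewrite ltnNge iz.
have lid : i < d.+1 + i by rewrite addSn ltnS leq_addl.
rewrite !(iprod_cons _ _ lid); have := IHd i.+1; rewrite addnS addSn => -[IH1 IH2].
split=> [|p q]; first by rewrite /= IH1.
split=> [/sch_mulP[[p' -> /IH2[z [iz zd -> ->]]]|[q' -> /=]]|].
- by exists z; rewrite (ltnW iz) -iprod_cons.
- rewrite inE => /eqP[-> ->]; exists i; rewrite IH1 iprod_nil leqnn.
  by rewrite -iprod_cons ?ltnS ?leq_addl.
move=> [z [iz zd -> ->]]; apply/sch_mulP.
move: iz; rewrite leq_eqVlt => /predU1P[<-|iz]; [right|left].
  exists (lam i); first by rewrite IH1 -iprod_cons // ltnS leq_addl.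
  by rewrite /= iprod_nil inE.
exists (iprod op lam i.+1 z); first by rewrite iprod_cons.
by apply/IH2; exists z.
Qed.

(** * Definable properties of increasing tuples of positions *)

Section FODefinable.
Variables (W : Type) (L : (W -> nat -> Prop) -> Prop).
Hypothesis tcL : temporal_class L.

(* Only nondecreasing values of the variables listed in [sigma] are described; a
   formula is definable when it is so for every listing of its variables. *)
Definition fo_definable (sigma : seq nat) (phi : W -> (nat -> nat) -> Prop) :=
  exists (M : finType) (e : M) (op : Monoid.law e) (lam : W -> nat -> M)
         (G : seq M -> W -> nat -> Prop),
    [/\ aperiodic e op, definable L lam, forall ms, L (G ms) &
        forall w v, path leq 0 (map v sigma) ->
          (phi w v <-> G (pairmap (iprod op (lam w)) 0 (map v sigma)) w
                         (last 0 (map v sigma)))].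

Lemma fod_ext sigma phi phi' :
  (forall w v, path leq 0 (map v sigma) -> (phi w v <-> phi' w v)) ->
  fo_definable sigma phi -> fo_definable sigma phi'.
Proof.
move=> E [M [e [op [lam [G [apM Llam LG phiG]]]]]]; exists M, e, op, lam, G.
by split=> // w v sv; rewrite -phiG // E.
Qed.

Lemma fod_not sigma phi :
  fo_definable sigma phi -> fo_definable sigma (fun w v => ~ phi w v).
Proof.
move=> [M [e [op [lam [G [apM Llam LG phiG]]]]]].
exists M, e, op, lam, (fun ms w i => ~ G ms w i).
split=> // [ms|w v sv]; first exact: tc_not.
by rewrite phiG.
Qed.

(** Both labellings run in parallel in the direct product, and the projections recover the two lists
    of products. *)
Lemma fod_or sigma phi1 phi2 : fo_definable sigma phi1 -> fo_definable sigma phi2 ->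
  fo_definable sigma (fun w v => phi1 w v \/ phi2 w v).
Proof.
move=> [M1 [e1 [op1 [lam1 [G1 [ap1 Llam1 LG1 phiG1]]]]]].
move=> [M2 [e2 [op2 [lam2 [G2 [ap2 Llam2 LG2 phiG2]]]]]].
exists (M1 * M2)%type, (e1, e2), (prod_mul op1 op2).
exists (fun w i => (lam1 w i, lam2 w i)).
exists (fun ms w i => G1 (map fst ms) w i \/ G2 (map snd ms) w i).
split=> [|[m1 m2]|ms|w v sv]; first exact: prod_aperiodic.
- apply: tc_ext (tc_and tcL (Llam1 m1) (Llam2 m2)) => // w i.
  by split=> [[-> ->]|[-> ->]].
- exact: tc_or.
rewrite phiG1 // phiG2 // !map_pairmap.
have -> : (fun a b => (iprod (prod_mul op1 op2) (fun i => (lam1 w i, lam2 w i)) a b).1)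
    = iprod op1 (lam1 w).
  by apply/funext => a; apply/funext => b; exact: (iprod_morph (h := fst)).
have -> // : (fun a b => (iprod (prod_mul op1 op2) (fun i => (lam1 w i, lam2 w i)) a b).2)
    = iprod op2 (lam2 w).
by apply/funext => a; apply/funext => b; exact: (iprod_morph (h := snd)).
Qed.

Lemma fod_and sigma phi1 phi2 : fo_definable sigma phi1 -> fo_definable sigma phi2 ->
  fo_definable sigma (fun w v => phi1 w v /\ phi2 w v).
Proof.
move=> d1 d2; apply: fod_ext (fod_not (fod_or (fod_not d1) (fod_not d2))) => w v _.
by rewrite not_orE !notE.
Qed.

(** Positions are labelled with the truth of [P] in the [first_some] monoid. The product from [v x]
    to the last position is the label at [v x]; it is [None] when [v x] is itself last, and then [P]
    is evaluated there directly. *)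
Lemma fod_label sigma P x : L P -> x \in sigma ->
  fo_definable sigma (fun w v => P w (v x)).
Proof.
move=> LP /splitPr[s1 s2].
exists (option bool), None, (@first_some bool), (fun w i => Some `[< P w i >]).
exists (fun ms w i =>
  (* Dropping [(size s1).+1] entries leaves exactly the intervals after [x]. *)
  if \big[@first_some bool/None]_(m <- drop (size s1).+1 ms) m is Some b
  then is_true b else P w i).
split=> [|[b|]|ms|w v]; first exact: first_some_aperiodic.
- case: b; [apply: tc_ext LP | apply: tc_ext (tc_not tcL LP)] => // w i; split.
  + by move=> Pi; congr Some; apply/asboolP.
  + by move=> [/asboolP].
  + by move=> nPi; congr Some; apply: asboolF.
  + by move=> [E]; apply/asboolPn; rewrite E.
- by apply: tc_ext (tc_const tcL False) => // w i; split.
- case: (\big[@first_some bool/None]_(m <- drop (size s1).+1 ms) m) => [b|] //.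
  exact: tc_const.
rewrite map_cat /= cat_path /= => /and3P[_ _ ps2].
rewrite drop_pairmap ?size_map // iprod_pairmap // last_cat /= iprod_first_some ?path_leq_last //.
by case: eqP => [<-//|_]; split=> /asboolP.
Qed.

Lemma fod_const sigma (A : Prop) : fo_definable sigma (fun _ _ => A).
Proof.
exists (option bool), None, (@first_some bool), (fun _ _ => None), (fun _ _ _ => A).
split=> // [|m|ms]; [exact: first_some_aperiodic|exact: tc_const|exact: tc_const].
Qed.

(** If [y] is not listed after [x], then [v y <= v x] and the formula is false. Otherwise
    [v x < v y] means that the interval between them is nonempty, that is, its product of [Some tt]
    is not [None]. *)
Lemma fod_lt sigma x y : x \in sigma -> y \in sigma ->
  fo_definable sigma (fun _ v => v x < v y).
Proof.
move=> /splitPr[s1 s2]; rewrite mem_cat inE => sy.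
have [s2y|s2y] := boolP (y \in s2); last first.
  apply: fod_ext (fod_const _ False) => w v; rewrite map_cat => pv; split=> // vxy.
  have: v y <= v x; last by rewrite leqNgt vxy.
  move: sy; rewrite (negPf s2y) orbF => /orP[s1y|/eqP-> //].
  move: pv; case/splitPr: (map_f v s1y) => s3 s4.
  rewrite -catA cat_path /= => /and3P[_ _ /path_leq_mem]; apply.
  by rewrite mem_cat mem_head orbT.
have {sy s2y} [s3 s4] := splitPr s2y.
exists (option unit), None, (@first_some unit), (fun _ _ => Some tt).
exists (fun ms _ _ =>
  \big[@first_some unit/None]_(m <- take (size s3).+1 (drop (size s1).+1 ms)) m <> None).
split=> [|m|ms|w v]; first exact: first_some_aperiodic.
- exact: tc_const.
- exact: tc_const.
rewrite map_cat /= map_cat /= -(cat_rcons (v y)) cat_path /= => /and3P[_ _].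
rewrite cat_path => /andP[p3 _].
rewrite drop_pairmap ?size_map // pairmap_cat take_size_cat ?size_pairmap ?size_rcons ?size_map //.
rewrite iprod_pairmap // last_rcons iprod_first_some; last first.
  by move: (path_leq_last p3); rewrite last_rcons.
have := path_leq_last p3; rewrite last_rcons leq_eqVlt.
by case: eqP => [->|_ /= ->] //; rewrite ltnn; split.
Qed.

Lemma map_update (v : nat -> nat) x d (s : seq nat) : x \notin s ->
  map [eta v with x |-> d] s = map v s.
Proof.
move=> xs; apply/eq_in_map => y sy /=.
by case: eqP sy xs => // -> ->.
Qed.

(** A position [d] after the last one whose new interval multiplies to [m] is what [factor] with a
    trivial guard asserts; a finite disjunction over [m] remains. *)
Lemma fod_exists_last sigma x phi : x \notin sigma ->
  fo_definable (rcons sigma x) phi ->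
  fo_definable sigma (fun w v => exists d, let v' := [eta v with x |-> d] in
    path leq 0 (map v' (rcons sigma x)) /\ phi w v').
Proof.
move=> xs [M [e [op [lam [G [apM Llam LG phiG]]]]]].
exists M, e, op, lam, (fun ms w i => exists m,
  factor op (lam w) (fun=> True) m (G (rcons ms m) w) i).
split=> // [ms|w v sv].
  by apply: tc_exists => // m; apply: (tc_factor tcL) => //; exact: tc_true.
have map_v d : map [eta v with x |-> d] (rcons sigma x) = rcons (map v sigma) d.
  by rewrite map_rcons map_update //= eqxx.
split=> [[d /= []]|[m [d [ld _ Em Gd]]]].
  move=> pd; rewrite phiG // map_v => Gd.
  exists (iprod op (lam w) (last 0 (map v sigma)) d), d; split=> //.
    by move: pd; rewrite map_v rcons_path => /andP[].
  by move: Gd; rewrite -cats1 pairmap_cat last_cat /= cats1.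
exists d => /=; rewrite phiG map_v rcons_path sv //= ld; split=> //.
by rewrite -!cats1 pairmap_cat last_cat /= cats1 Em.
Qed.

(** In the Schutzenberger product, the entry for the interval ending at [y] lists the pairs of
    products obtained by cutting it at the new position. *)
Lemma fod_exists_mid s1 y s2 x phi : x \notin s1 ++ y :: s2 ->
  fo_definable (s1 ++ x :: y :: s2) phi ->
  fo_definable (s1 ++ y :: s2) (fun w v => exists d, let v' := [eta v with x |-> d] in
    path leq 0 (map v' (s1 ++ x :: y :: s2)) /\ phi w v').
Proof.
move=> xs [M [e [op [lam [G [apM Llam LG phiG]]]]]].
exists (M * {set M * M})%type, (sch_one e), (sch_mul op).
exists (fun w i => (lam w i, [set (e, lam w i)])).
exists (fun ms w i => exists pq : M * M,
  let m := nth (sch_one e) ms (size s1) in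
  (* The second alternative is the cut at [y] itself, which the set does not contain. *)
  (pq \in m.2 \/ pq = (m.1, e)) /\
  G (map fst (take (size s1) ms) ++
     pq.1 :: pq.2 :: map fst (drop (size s1).+1 ms)) w i).
split=> [|[m P]|ms|w v].
- exact: sch_aperiodic.
- apply: tc_ext (tc_and tcL (Llam m) (tc_const tcL ([set (e, m)] = P))) => // w i.
  by split=> [[-> ->]|[-> <-]].
- by apply: tc_exists => // pq; apply: tc_and => //; exact: tc_const.
have map_v d : map [eta v with x |-> d] (s1 ++ x :: y :: s2) =
    map v s1 ++ d :: v y :: map v s2.
  move: xs; rewrite mem_cat inE !negb_or => /and3P[xs1 xy xs2].
  by rewrite map_cat /= eqxx (eq_sym y) (negPf xy) !map_update.
rewrite map_cat /= cat_path /= => /and3P[p1 ly p2].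
set a := last 0 (map v s1) in ly *.
have Efst i j : (iprod (sch_mul op) (fun k => (lam w k, [set (e, lam w k)])) i j).1
    = iprod op (lam w) i j by exact: (iprod_morph (h := fst)).
rewrite drop_pairmap ?size_map // pairmap_cat /=.
rewrite nth_cat size_pairmap size_map ltnn subnn /=.
rewrite take_size_cat ?size_pairmap ?size_map //.
rewrite !map_pairmap -/a Efst.
have -> : (fun a b => (iprod (sch_mul op) (fun k => (lam w k, [set (e, lam w k)])) a b).1)
    = iprod op (lam w) by apply/funext => i; apply/funext.
have [_ pairP] := sch_iprod op (lam w) ly.
have Gd d : G (pairmap (iprod op (lam w)) 0 (map [eta v with x |-> d] (s1 ++ x :: y :: s2)))
   w (last 0 (map [eta v with x |-> d] (s1 ++ x :: y :: s2))) =
  G (pairmap (iprod op (lam w)) 0 (map v s1) ++ iprod op (lam w) a d ::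
     iprod op (lam w) d (v y) :: pairmap (iprod op (lam w)) (v y) (map v s2)) w
    (last 0 (map v s1 ++ v y :: map v s2)).
  by rewrite map_v pairmap_cat /= !last_cat.
split=> [[d /= [pd]]|[[p q] /= [pq Gpq]]].
  rewrite phiG // Gd => Gad; exists (iprod op (lam w) a d, iprod op (lam w) d (v y)).
  split=> //; move: pd; rewrite map_v cat_path /= => /and4P[_ ad dy _].
  move: dy; rewrite leq_eqVlt => /predU1P[->|dy]; [right|left].
    by rewrite iprod_nil.
  by apply/pairP; exists d.
suff [d [ad dy Ep Eq]] : exists d, [/\ a <= d, d <= v y, p = iprod op (lam w) a d
    & q = iprod op (lam w) d (v y)].
  have pd : path leq 0 (map [eta v with x |-> d] (s1 ++ x :: y :: s2)).
    by rewrite map_v cat_path p1 /= -/a ad dy.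
  by exists d => /=; split=> //; rewrite phiG // Gd -Ep -Eq.
case: pq => [/pairP[d [ad dy Ep Eq]]|[-> ->]]; first by exists d; rewrite ad ltnW.
by exists (v y); rewrite iprod_nil ly.
Qed.

Lemma fod_exists_lt sigma n (phi : nat -> W -> (nat -> nat) -> Prop) :
  (forall k, k < n -> fo_definable sigma (phi k)) ->
  fo_definable sigma (fun w v => exists2 k, k < n & phi k w v).
Proof.
elim: n => [_|n IHn dphi].
  by apply: fod_ext (fod_const sigma False) => w v _; split=> // -[].
have dn : fo_definable sigma (fun w v => exists2 k, k < n & phi k w v).
  by apply: IHn => k kn; apply: dphi; rewrite ltnS ltnW.
apply: fod_ext (fod_or dn (dphi n (ltnSn n))) => w v _; split.
  by case=> [[k kn pk]|pn]; [exists k; rewrite ?ltnS 1?ltnW|exists n].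
case=> k; rewrite ltnS leq_eqVlt => /predU1P[->|kn] pk; [by right|left].
by exists k.
Qed.

(** The new value fits into one of finitely many slots of the listing, and each slot is one
    disjunct. *)
Lemma fod_exists sigma x phi : x \notin sigma ->
  (forall s1 s2, sigma = s1 ++ s2 -> fo_definable (s1 ++ x :: s2) phi) ->
  fo_definable sigma (fun w v => exists d, phi w [eta v with x |-> d]).
Proof.
move=> xs dphi.
pose psi k w v := exists d, let v' := [eta v with x |-> d] in
  path leq 0 (map v' (take k sigma ++ x :: drop k sigma)) /\ phi w v'.
have dpsi k : fo_definable sigma (psi k).
  have := dphi _ _ (esym (cat_take_drop k sigma)); rewrite /psi.
  rewrite -[in fo_definable sigma](cat_take_drop k sigma).
  rewrite -[in x \notin _](cat_take_drop k sigma) in xs.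
  case: (drop k sigma) xs => [|y s2] xs.
    by rewrite cats0 cats1 in xs *; exact: fod_exists_last.
  exact: fod_exists_mid.
apply: fod_ext (fod_exists_lt (n := (size sigma).+1) (fun k _ => dpsi k)).
move=> w v sv; split=> [[k _ [d [_ phid]]]|[d phid]]; first by exists d.
have [k ks pk] := path_leq_insert sv (leq0n d).
exists k; first by rewrite size_map in ks.
have xk s : {subset s <= sigma} -> x \notin s by move=> ss; apply: contra xs; apply: ss.
have xt : x \notin take k sigma by apply: xk => y; exact: mem_take.
have xd : x \notin drop k sigma by apply: xk => y; exact: mem_drop.
by exists d; split=> //; rewrite map_cat /= eqxx !map_update // map_take map_drop.
Qed.

(** With no variables there are no intervals, and the last position is the default 0. *)
Lemma fod_sentence phi :
  fo_definable [::] phi -> exists2 P, L P & forall w v, phi w v <-> P w 0.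
Proof.
move=> [M [e [op [lam [G [_ _ LG phiG]]]]]]; exists (G [::]) => // w v.
exact: phiG.
Qed.

End FODefinable.

From mathcomp Require Import classical_sets.

(** * From HyperFO to HyperLTL *)

Section Translation.
Variable AP : finType.
Implicit Types (T : set (trace AP)) (psi : ltl AP) (m : fo AP).

Definition full_structure : fo_structure AP :=
  @FOStructure AP (trace AP * nat)%type
    (fun d e => d.1 = e.1 /\ d.2 < e.2)
    (fun d e => d.2 = e.2)
    (fun a d => a \in d.1 d.2).

Definition quantify (Q : quantifier) (A : nat -> Prop) : Prop :=
  match Q with QEx => exists n, A n | QAll => forall n, A n end.

Lemma eq_quantify Q A A' : (forall n, A n <-> A' n) -> quantify Q A <-> quantify Q A'.
Proof.
by move=> AA'; case: Q; split=> H; try move: H => [n /AA']; try move=> n;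
  [exists n|exists n|exact/AA'|exact/AA'].
Qed.

(* The guarded quantifiers do not see the set of traces: [n] ranges over the
   positions of the trace of the guard. *)
Fixpoint guarded_sat (Pi : var -> trace AP) (u : assignment full_structure)
    (qys : seq (quantifier * var * var)) m : Prop :=
  if qys is (Q, y, x) :: qys' then
    quantify Q (fun n => guarded_sat Pi (update u y (Pi x, n)) qys' m)
  else fo_sat u m.

Lemma fo_sat_agree (u u' : assignment full_structure) m : fo_qfree m ->
  {in fo_fv m, u =1 u'} -> fo_sat u m <-> fo_sat u' m.
Proof.
elim: m => //= [x y|x y|x y|a x|m IHm|m1 IH1 m2 IH2|m1 IH1 m2 IH2|m1 IH1 m2 IH2].
1-3: by move=> _ E; rewrite /holds2 !E ?inE ?eqxx ?orbT.
- by move=> _ E; rewrite !E ?inE ?eqxx ?orbT.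
- by move=> qm E; rewrite (IHm qm E).
all: move=> /andP[q1 q2] E.
all: have E1 : {in fo_fv m1, u =1 u'} by move=> x mx; apply: E; rewrite mem_cat mx.
all: have E2 : {in fo_fv m2, u =1 u'} by move=> x mx; apply: E; rewrite mem_cat mx orbT.
all: by rewrite (IH1 q1 E1) (IH2 q2 E2).
Qed.

Lemma guarded_sat_agree Pi u u' qys m : fo_qfree m ->
  {in fo_fv m, forall y, y \in [seq q.1.2 | q <- qys] \/ u y = u' y} ->
  guarded_sat Pi u qys m <-> guarded_sat Pi u' qys m.
Proof.
move=> qm; elim: qys u u' => [|[[Q y] x] qys IHq] u u' E /=.
  by apply: fo_sat_agree => // y /E[].
apply: eq_quantify => n; apply: IHq => z mz; rewrite /update.
have [zy|/negPf zy] := eqVneq z y; first by right.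
by have := E z mz; rewrite /= inE zy.
Qed.

(** * Quantifier prefixes over a fixed set of traces *)

Section Structure.
Variable T : set (trace AP).
Local Notation M := (trace_structure T).

Definition embed (u : assignment M) : assignment full_structure :=
  fun y => omap (fun d : M => (val d.1 : trace AP, d.2)) (u y).

Lemma embed_update (u : assignment M) y d :
  embed (update u y d) = update (embed u) y (val d.1 : trace AP, d.2).
Proof. by apply/funext => z; rewrite /embed /update; case: eqP. Qed.

Lemma fo_sat_embed (u : assignment M) m : fo_qfree m ->
  fo_sat u m <-> fo_sat (embed u) m.
Proof.
elim: m => //= [x y|x y|x y|a x|m IHm|m1 IH1 m2 IH2|m1 IH1 m2 IH2|m1 IH1 m2 IH2].
- move=> _; rewrite /holds2 /embed; case: (u x) => [[t n]|]; case: (u y) => [[t' n']|] //=.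
  by split=> [[-> ->]//|[/val_inj -> ->]].
- move=> _; rewrite /holds2 /embed; case: (u x) => [[t n]|]; case: (u y) => [[t' n']|] //=.
  by split=> [[-> ->]//|[/val_inj -> ->]].
- by move=> _; rewrite /holds2 /embed; case: (u x) => [[t n]|]; case: (u y) => [[t' n']|].
- by move=> _; rewrite /embed; case: (u x) => [[t n]|].
- by move=> qm; rewrite IHm.
all: by move=> /andP[q1 q2]; rewrite IH1 // IH2.
Qed.

Lemma fo_sat_FLe (u : assignment M) x y (t t' : set_type T) n n' :
  u x = Some (t, n) -> u y = Some (t', n') ->
  fo_sat u (FLe AP x y) <-> t = t' /\ n <= n'.
Proof.
move=> ux uy; rewrite /= /holds2 ux uy /=; split.
  by case=> [[-> /ltnW]|[-> ->]].
move=> [->]; rewrite leq_eqVlt => /predU1P[->|]; [by right|by left].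
Qed.

Lemma fo_sat_FMin (u : assignment M) x (t : set_type T) n :
  u x = Some (t, n) -> fo_sat u (FMin AP x) <-> n = 0.
Proof.
move=> ux.
(* [FMin] binds [x.+1], and the [FSucc] inside it binds [x.+2]; these facts resolve the updates. *)
have sx : x == x.+1 = false by apply/eqP; lia.
have mx : maxn x.+1 x = x.+1 by lia.
have sxx : x == x.+2 = false by apply/eqP; lia.
have ssx : x.+1 == x.+2 = false by apply/eqP; lia.
rewrite /= /holds2 mx /update !eqxx /= sx sxx ssx ux; split.
  case: n {ux} => // n nsucc; case: nsucc; exists (t, n) => /=; split=> //.
  by move=> [[t' n']] /= [[_ nn'] [_ n'n]]; lia.
by move=> -> [[t' n']] /= [[_]].
Qed.

Definition matched (u : assignment M) (Pi : assignment (trace AP)) (x : var) :=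
  exists t : set_type T, u x = Some (t, 0) /\ Pi x = Some (val t : trace AP).

(** A guard sits at position 0 of its trace, so [x <= y] says only that [y] lies on that trace, at
    any position. Guards are not rebound by the prefix, hence keep their values. *)
Lemma fo_sat_FPrefixG (Pi : var -> trace AP) (u : assignment M)
    (qys : seq (quantifier * var * var)) m :
  fo_qfree m ->
  {in [seq q.2 | q <- qys], forall x, matched u (fun x => Some (Pi x)) x} ->
  {in [seq q.1.2 | q <- qys] & [seq q.2 | q <- qys], forall y x, y != x} ->
  fo_sat u (FPrefixG qys m) <-> guarded_sat Pi (embed u) qys m.
Proof.
move=> qm; elim: qys u => [|[[Q y] x] qys IHq] u uPi disj; first exact: fo_sat_embed.
have [t [ux [Pix]]] := uPi _ (mem_head _ _); rewrite /= in ux Pix.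
have yx : x == y = false.
  by apply/negbTE; rewrite eq_sym; exact: disj (mem_head _ _) (mem_head _ _).
have step n : fo_sat (update u y (t, n)) (FPrefixG qys m) <->
    guarded_sat Pi (update (embed u) y (Pi x, n)) qys m.
  rewrite IHq ?embed_update ?Pix // => [z qz|y' z qy' qz].
    rewrite /matched /update ifN; first by apply: uPi; rewrite inE qz orbT.
    by rewrite eq_sym; apply: disj; rewrite ?mem_head // inE qz orbT.
  by apply: disj; rewrite inE ?qy' ?qz orbT.
have guard t' n : fo_sat (update u y (t', n)) (FLe AP x y) <-> t = t'.
  rewrite (@fo_sat_FLe _ _ _ t t' 0 n) /update ?yx ?eqxx //.
  by split=> [[]|->].
case: Q {IHq uPi disj} => /=; split.
- by move=> [[t' n] [/guard <- /step]]; exists n.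
- by move=> [n /step sn]; exists (t, n); split=> //; apply/guard.
- by move=> sat n; apply/step/sat/guard.
- by move=> sat [t' n] /guard <-; apply/step/sat.
Qed.

Definition hprefix (qxs : seq (quantifier * var)) psi : hyperltl AP :=
  foldr (fun q => match q.1 with QEx => HEx q.2 | QAll => HAll q.2 end)
    (HBody psi) qxs.

(** A minimal element is a pair (t, 0), so quantifying over it is quantifying over the trace t. The
    list [xs] collects the variables already quantified. *)
Lemma prefix_equiv (xs : seq var) qxs body psi u Pi :
  (forall u Pi, {in xs ++ [seq q.2 | q <- qxs], forall x, matched u Pi x} ->
     fo_sat u body <-> ltl_sat Pi psi) ->
  {in xs, forall x, matched u Pi x} ->
  fo_sat u (FPrefixM qxs body) <-> hyperltl_sat T Pi (hprefix qxs psi).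
Proof.
elim: qxs xs u Pi => [|[Q x] qxs IHq] xs u Pi bodyP uPi /=.
  by apply: bodyP => x; rewrite cats0; exact: uPi.
have step (t : set_type T) : fo_sat (update u x (t, 0)) (FPrefixM qxs body) <->
    hyperltl_sat T (update Pi x (val t)) (hprefix qxs psi).
  apply: (IHq (rcons xs x)) => [u' Pi'|z]; first by rewrite cat_rcons; exact: bodyP.
  rewrite mem_rcons inE /matched /update; case: eqP => [_ _|_ /uPi //].
  by exists t.
have minP (t : set_type T) n : fo_sat (update u x (t, n)) (FMin AP x) <-> n = 0.
  by apply: fo_sat_FMin; rewrite /update eqxx.
have inT (t : set_type T) : T (val t) by exact: set_valP.
have ofT t : T t -> exists t' : set_type T, val t' = t.
  by move=> Tt; exists (Sub t (mem_set Tt)); rewrite SubK.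
case: Q {bodyP uPi IHq} => /=; split.
- by move=> [[t n] [/minP -> /step]]; exists (val t).
- move=> [_ /ofT[t <-] /step sat]; exists (t, 0); split=> //; exact/minP.
- by move=> sat _ /ofT[t <-]; apply/step/sat/minP.
- by move=> sat [t n] /minP ->; apply/step/sat.
Qed.

End Structure.

Lemma prefix_models T qxs body psi :
  (forall (u : assignment (trace_structure T)) Pi,
     {in [seq q.2 | q <- qxs], forall x, matched u Pi x} ->
     fo_sat u body <-> ltl_sat Pi psi) ->
  fo_models (trace_structure T) (FPrefixM qxs body) <->
  hyperltl_models T (hprefix qxs psi).
Proof. by move=> bodyP; apply: (@prefix_equiv T [::]). Qed.

Lemma ltl_sat_agree (Pi Pi' : assignment (trace AP)) psi :
  {in ltl_fv psi, Pi =1 Pi'} -> ltl_sat Pi psi <-> ltl_sat Pi' psi.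
Proof.
elim: psi Pi Pi' => /= [a p|psi IH|psi1 IH1 psi2 IH2|psi IH|psi1 IH1 psi2 IH2] Pi Pi' E.
- by rewrite E ?mem_head.
- by rewrite (IH _ _ E).
- rewrite (IH1 Pi Pi') ?(IH2 Pi Pi') // => x mx; apply: E; rewrite mem_cat mx ?orbT //.
- by apply: IH => x mx; rewrite /shift E.
have E1 j : ltl_sat (shift j Pi) psi1 <-> ltl_sat (shift j Pi') psi1.
  by apply: IH1 => x mx; rewrite /shift E // mem_cat mx.
have E2 j : ltl_sat (shift j Pi) psi2 <-> ltl_sat (shift j Pi') psi2.
  by apply: IH2 => x mx; rewrite /shift E // mem_cat mx orbT.
by split=> -[j /E2 s2 s1]; exists j => // j' /s1/E1.
Qed.

Definition ltl_at (Pi : var -> trace AP) (i : nat) psi : Prop :=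
  ltl_sat (fun x => Some (Defs.suffix i (Pi x))) psi.

Lemma shift_suffix j i (Pi : var -> trace AP) :
  shift j (fun x => Some (Defs.suffix i (Pi x))) = fun x => Some (Defs.suffix (i + j) (Pi x)).
Proof.
by apply/funext => x; congr Some; apply/funext => n; rewrite /Defs.suffix addnA.
Qed.

Lemma ltl_at_until Pi i psi1 psi2 :
  ltl_at Pi i (LUntil psi1 psi2) <->
  exists j, [/\ i <= j, forall k, i <= k < j -> ltl_at Pi k psi1 & ltl_at Pi j psi2].
Proof.
split=> [[j]|[j [ij s1 s2]]].
  rewrite shift_suffix => s2 s1; exists (i + j); split=> // [|k /andP[ik kj]].
    exact: leq_addr.
  have := s1 (k - i); rewrite shift_suffix subnKC //; apply.
  by rewrite ltn_subLR.
exists (j - i) => [|j' j'j]; rewrite shift_suffix ?subnKC //.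
by apply: s1; rewrite leq_addr -ltn_subRL.
Qed.

Definition ltl_definable (xs : seq var) (P : (var -> trace AP) -> nat -> Prop) :=
  exists2 psi, {subset ltl_fv psi <= xs} & forall Pi i, P Pi i <-> ltl_at Pi i psi.

Lemma ltl_definable_atom xs a x :
  x \in xs -> ltl_definable xs (fun Pi i => a \in Pi x i).
Proof.
move=> xsx; exists (LAtom a x) => [y|Pi i]; first by rewrite inE => /eqP->.
by rewrite /ltl_at /= /Defs.suffix addn0.
Qed.

(** LTL here has no constant for truth; an atomic proposition and a trace variable provide it as an
    instance of excluded middle. *)
Lemma ltl_temporal_class xs :
  0 < #|AP| -> xs <> [::] -> temporal_class (ltl_definable xs).
Proof.
move=> /card_gt0P[a _] xs0.
have or_closed P P' : ltl_definable xs P -> ltl_definable xs P' ->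
    ltl_definable xs (fun Pi i => P Pi i \/ P' Pi i).
  move=> [psi fpsi Ppsi] [psi' fpsi' Ppsi']; exists (LOr psi psi') => [x|Pi i].
    by rewrite mem_cat => /orP[/fpsi|/fpsi'].
  by rewrite Ppsi Ppsi'.
have not_closed P : ltl_definable xs P -> ltl_definable xs (fun Pi i => ~ P Pi i).
  by move=> [psi fpsi Ppsi]; exists (LNot psi) => // Pi i; rewrite Ppsi.
have ext P P' : (forall Pi i, P Pi i <-> P' Pi i) -> ltl_definable xs P ->
    ltl_definable xs P'.
  by move=> PP' [psi fpsi Ppsi]; exists psi => // Pi i; rewrite -PP'.
split=> //.
- have [x xsx] : exists x, x \in xs.
    by case: xs xs0 {or_closed not_closed ext} => // x xs; exists x; exact: mem_head.
  have La := ltl_definable_atom a xsx.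
  by apply: ext (or_closed _ _ La (not_closed _ La)) => Pi i; split=> // _; exact: EM.
- move=> P [psi fpsi Ppsi]; exists (LNext psi) => // Pi i.
  by rewrite Ppsi /ltl_at /= shift_suffix addn1.
move=> P P' [psi fpsi Ppsi] [psi' fpsi' Ppsi'].
exists (LUntil psi psi') => [x|Pi i]; first by rewrite mem_cat => /orP[/fpsi|/fpsi'].
rewrite ltl_at_until.
by split=> -[j [ij s1 s2]]; exists j; split=> // [k /s1/Ppsi|]; rewrite ?Ppsi' // -Ppsi'.
Qed.

Lemma exists_fresh (s : seq nat) : exists t, t \notin s.
Proof.
exists (\max_(i <- s) i).+1; apply/negP => sm.
by have := @leq_bigmax_seq _ s xpredT id _ sm isT; rewrite ltnn.
Qed.

(** * Kamp's theorem at position 0 for a tuple of traces *)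

Section Kamp.
Variable xs : seq var.
Hypothesis tcL : temporal_class (ltl_definable xs).
Local Notation fod := (fo_definable (ltl_definable xs)).

(** Two traces are equal when no position distinguishes them, so equality is one more quantifier
    over positions, eliminated by [fod_exists]. *)
Lemma fod_trace_eq sigma x x' : x \in xs -> x' \in xs ->
  fod sigma (fun Pi _ => Pi x = Pi x').
Proof.
move=> xsx xsx'; have [t st] := exists_fresh sigma.
have Lx : ltl_definable xs (fun Pi i => Pi x i <> Pi x' i).
  have Lne a : ltl_definable xs (fun Pi i =>
      a \in Pi x i /\ ~ a \in Pi x' i \/ a \in Pi x' i /\ ~ a \in Pi x i).
    have Lx := ltl_definable_atom a xsx; have Lx' := ltl_definable_atom a xsx'.
    have L1 := tc_and tcL Lx (tc_not tcL Lx').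
    have L2 := tc_and tcL Lx' (tc_not tcL Lx).
    exact: (tc_or tcL L1 L2).
  apply: tc_ext (tc_exists tcL Lne) => // Pi i; split.
    by move=> [a ne] E; case: ne => -[]; rewrite E.
  move=> ne; apply: contrapT => nex; apply: ne; apply/finset.setP => a.
  by apply/idP/idP => ain; apply: contrapT => nain; apply: nex; exists a; [left|right].
have fe : fod sigma (fun Pi v => exists d, Pi x ([eta v with t |-> d] t)
                                  <> Pi x' ([eta v with t |-> d] t)).
  apply: (fod_exists tcL (phi := fun Pi v => Pi x (v t) <> Pi x' (v t))) => // s1 s2 _.
  by apply: (fod_label tcL Lx); rewrite mem_cat mem_head orbT.
apply: fod_ext (fod_not tcL fe) => Pi v _; split=> [nex|-> [d] //].
apply/funext => d; apply: contrapT => ne; apply: nex; exists d.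
by rewrite /= eqxx.
Qed.

(* [eta y = Some (l, x)]: the first-order variable [y] lies on the trace of [x], at
   the position denoted by [l]. *)
Definition located (eta : var -> option (nat * var)) (Pi : var -> trace AP)
    (v : nat -> nat) : assignment full_structure :=
  fun y => omap (fun lx => (Pi lx.2, v lx.1)) (eta y).

(** The trace of each variable is fixed by [eta]. Equality and order thus split into a trace
    equality and a comparison of positions, and equal level compares positions only. *)
Lemma fod_qfree sigma eta m : fo_qfree m ->
  (forall y l x, eta y = Some (l, x) -> l \in sigma /\ x \in xs) ->
  fod sigma (fun Pi v => fo_sat (located eta Pi v) m).
Proof.
move=> qm etaP; have lt_fod l l' : l \in sigma -> l' \in sigma ->
    fod sigma (fun _ v => v l < v l') by exact: fod_lt.
have eq_fod l l' : l \in sigma -> l' \in sigma -> fod sigma (fun _ v => v l = v l').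
  move=> sl sl'.
  apply: fod_ext (fod_not tcL (fod_or tcL (lt_fod l l' sl sl') (lt_fod l' l sl' sl))).
  by move=> Pi v _; split=> [|->]; [lia|case; rewrite ltnn].
have cF : fod sigma (fun _ _ => False) by exact: fod_const.
elim: m qm => //= [x y|x y|x y|a x|m IHm|m1 IH1 m2 IH2|m1 IH1 m2 IH2|m1 IH1 m2 IH2].
1-3: move=> _; rewrite /holds2 /located.
1-3: case Ex: (eta x) => [[l x0]|] //=; case Ey: (eta y) => [[l' y0]|] //=.
1-3: have [sl xsx] := etaP _ _ _ Ex; have [sl' xsy] := etaP _ _ _ Ey.
- have fe := fod_and tcL (fod_trace_eq sigma xsx xsy) (eq_fod l l' sl sl').
  by apply: fod_ext fe => Pi v _; split=> [[-> ->]|[-> ->]].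
- by have := fod_and tcL (fod_trace_eq sigma xsx xsy) (lt_fod l l' sl sl').
- exact: eq_fod.
- move=> _; rewrite /located; case Ex: (eta x) => [[l x0]|] //=.
  have [sl xsx] := etaP _ _ _ Ex.
  exact: (fod_label tcL (ltl_definable_atom a xsx) sl).
- by move=> /IHm; exact: fod_not.
all: move=> /andP[/IH1 f1 /IH2 f2].
- exact: fod_or.
- exact: fod_and.
apply: fod_ext (fod_or tcL (fod_not tcL f1) f2) => Pi v _.
split=> [[nf1 //|//]|f12].
by have [/f12|] := pselect (fo_sat (located eta Pi v) m1); [right|left].
Qed.

(** The variable [y] is relocated to the trace of its guard, at a fresh position variable [t]; this
    also covers a [y] that was quantified before. Universal quantifiers are treated as negated
    existential ones. *)
Lemma fod_guarded sigma eta qys m : fo_qfree m ->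
  {subset [seq q.2 | q <- qys] <= xs} ->
  (forall y l x, eta y = Some (l, x) -> l \in sigma /\ x \in xs) ->
  fod sigma (fun Pi v => guarded_sat Pi (located eta Pi v) qys m).
Proof.
move=> qm; elim: qys sigma eta => [|[[Q y] x] qys IHq] sigma eta qxs etaP.
  exact: fod_qfree.
have [t st] := exists_fresh sigma.
pose eta' := update eta y (t, x).
have xsx : x \in xs by apply: qxs; exact: mem_head.
have qxs' : {subset [seq q.2 | q <- qys] <= xs}.
  by move=> z qz; apply: qxs; rewrite inE qz orbT.
have eta'P s1 s2 : sigma = s1 ++ s2 -> forall z l x', eta' z = Some (l, x') ->
    l \in s1 ++ t :: s2 /\ x' \in xs.
  move=> E z l x'; rewrite /eta' /update; case: eqP => _.
    by move=> [<- <-]; rewrite mem_cat mem_head orbT.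
  move=> /etaP[]; rewrite E !mem_cat inE => sl xsx'; split=> //.
  by case/orP: sl => ->; rewrite ?orbT.
have E Pi v d : update (located eta Pi v) y (Pi x, d) =
    located eta' Pi [eta v with t |-> d].
  apply/funext => z; rewrite /located /eta' /update; case: eqP => _ /=.
    by rewrite eqxx.
  case Ez: (eta z) => [[l x']|] //=; have [sl _] := etaP _ _ _ Ez.
  by rewrite ifN //; apply: contra st => /eqP <-.
case: Q qxs => _ /=.
  have fe := fod_exists tcL st (fun s1 s2 Es => IHq _ _ qxs' (eta'P s1 s2 Es)).
  by apply: fod_ext fe => Pi v _; split=> -[d]; exists d; rewrite ?E // -E.
have fe := fod_exists tcL st (fun s1 s2 Es => fod_not tcL (IHq _ _ qxs' (eta'P s1 s2 Es))).
apply: fod_ext (fod_not tcL fe) => Pi v _; split.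
  by move=> nex d; rewrite E; apply: contrapT => nd; apply: nex; exists d.
by move=> all_d [d]; rewrite -E.
Qed.

(** Elimination starts with no located variable. The assignment [u] is arbitrary because the prefix
    binds every variable of [m]. *)
Lemma guarded_ltl qys m : fo_qfree m ->
  {subset [seq q.2 | q <- qys] <= xs} ->
  {subset fo_fv m <= [seq q.1.2 | q <- qys]} ->
  exists2 psi, {subset ltl_fv psi <= xs} &
    forall Pi u, guarded_sat Pi u qys m <-> ltl_at Pi 0 psi.
Proof.
move=> qm qxs qys_fv.
have etaP (y : var) l x : @None (nat * var) = Some (l, x) -> l \in [::] /\ x \in xs.
  by [].
have /fod_sentence[P [psi fpsi Ppsi] PE] := fod_guarded qm qxs etaP.
exists psi => // Pi u; rewrite -Ppsi -(PE Pi id).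
by apply: guarded_sat_agree => // y /qys_fv; left.
Qed.

End Kamp.

Lemma fo_fv_nonempty m : fo_qfree m -> exists y, y \in fo_fv m.
Proof.
elim: m => //= [x y|x y|x y|a x|m1 IH1 m2 _|m1 IH1 m2 _|m1 IH1 m2 _].
1-4: by exists x; rewrite mem_head.
all: by move=> /andP[/IH1[y m1y] _]; exists y; rewrite mem_cat m1y.
Qed.

Lemma hprefix_fv qxs psi x : x \in hyperltl_fv (hprefix qxs psi) ->
  x \in ltl_fv psi /\ x \notin [seq q.2 | q <- qxs].
Proof.
elim: qxs => //= -[[] y] qxs IHq /=; rewrite mem_filter => /andP[xy /IHq[fx nx]].
  by rewrite inE negb_or xy.
by rewrite inE negb_or xy.
Qed.

Lemma hprefix_sentence qxs psi :
  {subset ltl_fv psi <= [seq q.2 | q <- qxs]} -> hyperltl_sentence (hprefix qxs psi).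
Proof.
move=> sub; rewrite /hyperltl_sentence.
case E: hyperltl_fv => [//|x s]; have := @hprefix_fv qxs psi x.
by rewrite E mem_head => /(_ isT)[/sub ->].
Qed.

Lemma matched_total T (u : assignment (trace_structure T)) Pi xs :
  xs <> [::] -> {in xs, forall x, matched u Pi x} ->
  exists Pi' : var -> trace AP, {in xs, forall x, Pi x = Some (Pi' x)}.
Proof.
case: xs => // x0 xs _ uPi; have [t0 _] := uPi x0 (mem_head _ _).
exists (fun x => odflt (val t0 : trace AP) (Pi x)) => x /uPi[t [_ ->]].
by [].
Qed.

Lemma hyperfo_to_hyperltl m : 0 < #|AP| -> hyperfo m ->
  exists phi : hyperltl AP, hyperltl_sentence phi /\
    forall T, fo_models (trace_structure T) m <-> hyperltl_models T phi.
Proof.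
move=> AP0 [_ [qxs [qys [psi /= [disj guards qpsi fv_psi ->]]]]].
set xs := [seq q.2 | q <- qxs] in disj guards.
(* The matrix contains some variable, which is bound by a guarded quantifier, whose guard lies in
   [xs]. *)
have xs0 : xs <> [::].
  have [y /fv_psi] := fo_fv_nonempty qpsi.
  case: qys {fv_psi disj} guards => //= q qys guards _ xs0.
  by have := guards q.2 (mem_head _ _); rewrite xs0.
have [phi fphi phiP] := guarded_ltl (ltl_temporal_class AP0 xs0) qpsi guards fv_psi.
exists (hprefix qxs phi); split; first exact: hprefix_sentence.
move=> T; apply: prefix_models => u Pi uPi.
have [Pi' E] := matched_total xs0 uPi.
rewrite (fo_sat_FPrefixG (Pi := Pi')) //; last first.
- move=> y x qy /guards xsx; apply: contra disj => /eqP yx.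
  by apply/hasP; exists y => //=; rewrite yx.
- by move=> x /guards xsx; have [t [ut]] := uPi _ xsx; rewrite (E _ xsx); exists t.
rewrite phiP; apply: ltl_sat_agree => x /fphi/E ->; congr Some.
Qed.

End Translation.

(** * From HyperLTL to HyperFO *)

Section Prenex.
Variable AP : finType.
Implicit Types (T : set (trace AP)) (psi : ltl AP) (m : fo AP).
Implicit Types (qys : seq (quantifier * var * var)).
Local Notation full := (full_structure AP).
Local Notation bound qys := [seq q.1.2 | q <- qys].

Definition dual (Q : quantifier) : quantifier :=
  match Q with QEx => QAll | QAll => QEx end.

Lemma guarded_sat_not Pi (u : assignment full) qys m :
  guarded_sat Pi u [seq (dual q.1.1, q.1.2, q.2) | q <- qys] (FNot m) <->
  ~ guarded_sat Pi u qys m.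
Proof.
elim: qys u => [|[[[] y] x] qys IHq] u //=; split.
- by move=> all_n [n]; apply/IHq.
- by move=> nex n; apply/IHq => sn; apply: nex; exists n.
- by move=> [n /IHq nsat] all_n; exact: nsat.
move=> nall; apply: contrapT => nex; apply: nall => n.
by apply: contrapT => /IHq sn; apply: nex; exists n.
Qed.

Definition FConn (b : bool) m1 m2 : fo AP := if b then FAnd m1 m2 else FOr m1 m2.

Definition conn (b : bool) (A B : Prop) : Prop := if b then A /\ B else A \/ B.

Lemma fo_fv_conn b m1 m2 : fo_fv (FConn b m1 m2) = fo_fv m1 ++ fo_fv m2.
Proof. by case: b. Qed.

Lemma conn_iff b A A' B B' : (A <-> A') -> (B <-> B') -> conn b A B <-> conn b A' B'.
Proof. by case: b => /= -> ->. Qed.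

(** Prenexing is sound because positions form a nonempty domain, hence the witness 0; a universal
    quantifier over a disjunction needs excluded middle. *)
Lemma quantify_connl b Q A B :
  quantify Q (fun n => conn b (A n) B) <-> conn b (quantify Q A) B.
Proof.
case: Q b => -[] /=; split.
- by move=> [n [An b]]; split=> //; exists n.
- by move=> [[n An] b]; exists n.
- by move=> [n [An|b]]; [left; exists n|right].
- by move=> [[n An]|b]; [exists n; left|exists 0; right].
- by move=> AB; split=> [n|]; [case: (AB n)|case: (AB 0)].
- by move=> [An b] n.
- move=> AB; have [b|nb] := pselect B; [by right|left=> n].
  by case: (AB n).
- by move=> [An|b] n; [left|right].
Qed.

Lemma quantify_connr b Q A B :
  quantify Q (fun n => conn b A (B n)) <-> conn b A (quantify Q B).
Proof.
have connC X Y : conn b X Y <-> conn b Y X by case: b => /=; [exact: and_comm|exact: or_comm].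
rewrite connC -quantify_connl; apply: eq_quantify => n; exact: connC.
Qed.

Lemma guarded_sat_conn b Pi (u : assignment full) qys1 qys2 m1 m2 :
  fo_qfree m1 -> fo_qfree m2 ->
  {in fo_fv m1, forall y, y \notin bound qys2} ->
  {in fo_fv m2, forall y, y \notin bound qys1} ->
  guarded_sat Pi u (qys1 ++ qys2) (FConn b m1 m2) <->
  conn b (guarded_sat Pi u qys1 m1) (guarded_sat Pi u qys2 m2).
Proof.
move=> qm1 qm2 d12; elim: qys1 u => [|[[Q y] x] qys1 IHq] u d21 /=.
  elim: qys2 d12 u {d21} => [|[[Q y] x] qys2 IHq] d12 u /=; first by case: b.
  rewrite -quantify_connr; apply: eq_quantify => n; rewrite IHq; last first.
    by move=> z /d12; rewrite inE negb_or => /andP[].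
  apply: conn_iff => //; apply: fo_sat_agree => // z /d12; rewrite inE negb_or.
  by rewrite /update => /andP[/negPf ->].
rewrite -quantify_connl; apply: eq_quantify => n; rewrite IHq; last first.
  by move=> z /d21; rewrite inE negb_or => /andP[].
apply: conn_iff => //; apply: guarded_sat_agree => // z /d21; rewrite inE negb_or.
by rewrite /update => /andP[/negPf -> _]; right.
Qed.

Lemma fo_sat_FLt_full (u : assignment full) t x y n n' :
  u x = Some (t, n) -> u y = Some (t, n') -> fo_sat u (FLt AP x y) <-> n < n'.
Proof. by move=> ux uy; rewrite /= /holds2 ux uy /=; split=> [[]|]. Qed.

Lemma fo_sat_FLe_full (u : assignment full) t x y n n' :
  u x = Some (t, n) -> u y = Some (t, n') -> fo_sat u (FLe AP x y) <-> n <= n'.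
Proof.
move=> ux uy; rewrite /= /holds2 ux uy /=; split=> [[[_ /ltnW]|[->]]|] //.
by rewrite leq_eqVlt => /predU1P[->|]; [right|left].
Qed.

Lemma bound_below qys k : exists2 k' : nat, k <= k' & {in bound qys, forall z : var, z < k'}.
Proof.
exists (maxn k (\max_(z <- bound qys) z).+1) => [|z qz]; first exact: leq_maxl.
by rewrite leq_max ltnS (leq_bigmax_seq _ qz) ?orbT.
Qed.

(** The variable [y] marks the current time on the trace of [x]. All bound variables are at least
    [k], hence above [y], which prevents capture. *)
Lemma ltl_prenex (xs : seq var) psi x y k :
  {subset ltl_fv psi <= xs} -> x \in xs -> y < k ->
  exists qys m, [/\ fo_qfree m, {subset [seq q.2 | q <- qys] <= xs},
    {in bound qys, forall z : var, k <= z},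
    {in fo_fv m, forall z, z = y \/ z \in bound qys} &
    forall Pi (u : assignment full) n, u y = Some (Pi x, n) ->
      guarded_sat Pi u qys m <-> ltl_at Pi n psi].
Proof.
elim: psi x y k => /= [a x'|psi IH|psi1 IH1 psi2 IH2|psi IH|psi1 IH1 psi2 IH2]
  x y k fv xsx yk.
- have yk' : y == k = false by apply/eqP; lia.
  (* The level of [y] determines the position of [k] on the trace of [x']. *)
  exists [:: (QEx, k, x')], (FAnd (FLevel AP y k) (FPred a k)); split=> //=.
  + by move=> z; rewrite inE => /eqP ->.
  + by move=> z; rewrite !inE => /or3P[]/eqP ->; rewrite ?eqxx; [left|right|right].
  move=> Pi u n uy; rewrite /holds2 /ltl_at /= /Defs.suffix addn0 /update eqxx yk' uy /=.
  by split=> [[n' [->]]|a_n] //; exists n.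
- have [qys [m [qm gxs ks fvm satm]]] := IH x y k fv xsx yk.
  exists [seq (dual q.1.1, q.1.2, q.2) | q <- qys], (FNot m).
  have Eb : bound [seq (dual q.1.1, q.1.2, q.2) | q <- qys] = bound qys.
    by rewrite -map_comp.
  have Eg : [seq q.2 | q <- [seq (dual q.1.1, q.1.2, q.2) | q <- qys]] =
      [seq q.2 | q <- qys].
    by rewrite -map_comp.
  split; rewrite ?Eb ?Eg //.
  by move=> Pi u n uy; rewrite guarded_sat_not (satm _ _ _ uy); exact: iff_refl.
- have fv1 : {subset ltl_fv psi1 <= xs} by move=> z fz; apply: fv; rewrite mem_cat fz.
  have fv2 : {subset ltl_fv psi2 <= xs} by move=> z fz; apply: fv; rewrite mem_cat fz orbT.
  have [qys1 [m1 [qm1 g1 k1 fvm1 sat1]]] := IH1 x y k fv1 xsx yk.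
  (* The second prefix uses names above those of the first, so the two can be concatenated. *)
  have [k' kk' below] := bound_below qys1 k.
  have yk' := leq_trans yk kk'.
  have [qys2 [m2 [qm2 g2 k2 fvm2 sat2]]] := IH2 x y k' fv2 xsx yk'.
  exists (qys1 ++ qys2), (FConn false m1 m2); split.
  + by rewrite /= qm1.
  + by move=> z; rewrite map_cat mem_cat => /orP[/g1|/g2].
  + move=> z; rewrite map_cat mem_cat => /orP[/k1//|/k2]; exact: leq_trans.
  + move=> z; rewrite [fo_fv _]/= map_cat !mem_cat => /orP[/fvm1|/fvm2] [->|->];
      rewrite ?orbT; first [by left | by right].
  move=> Pi u n uy; rewrite guarded_sat_conn //.
  + rewrite /conn (sat1 _ _ _ uy) (sat2 _ _ _ uy); exact: iff_refl.
  + move=> z /fvm1[->|/below]; [apply: contraTN yk' => /k2|apply: contraTN => /k2]; lia.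
  + move=> z /fvm2[->|/k2]; first by apply: contraTN yk => /k1; lia.
    by apply: contraTN => /below; lia.
- have [qys [m [qm gxs ks fvm satm]]] := IH x k k.+2 fv xsx (leqnSn _).
  (* The formula makes [k] the successor of [y]: for every [k.+1], not y < k.+1 < k. The translation
     of [psi] then takes [k] as its current time and names from [k.+2] on. *)
  pose m0 := FAnd (FLt AP y k) (FOr (FNot (FLt AP y k.+1)) (FNot (FLt AP k.+1 k))).
  have m0fv z : z \in fo_fv m0 -> [\/ z = y, z = k | z = k.+1].
    rewrite /= !inE => m0z; have /or3P : [|| z == y, z == k | z == k.+1] by lia.
    by case=> /eqP; [constructor 1|constructor 2|constructor 3].
  exists [:: (QEx, k, x), (QAll, k.+1, x) & qys], (FConn true m0 m); split; first by [].
  + by move=> z; rewrite !inE => /or3P[/eqP->|/eqP->|/gxs].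
  + by move=> z; rewrite /= !inE => /or3P[/eqP->|/eqP->|/ks]; lia.
  + move=> z; rewrite fo_fv_conn mem_cat => /orP[/m0fv[]->|/fvm[->|zb]];
      rewrite /= ?inE ?eqxx ?orbT ?zb ?orbT; first [by left | by right].
  move=> Pi u n uy.
  have E n' n'' : guarded_sat Pi (update (update u k (Pi x, n')) k.+1 (Pi x, n''))
      qys (FConn true m0 m) <->
      (n < n' /\ (~ n < n'' \/ ~ n'' < n')) /\ ltl_at Pi n' psi.
    set u' := update _ _ _.
    have uy' : u' y = Some (Pi x, n) by rewrite /u' /update !ifN //; apply/eqP; lia.
    have uk : u' k = Some (Pi x, n').
      by rewrite /u' /update eqxx ifN //; apply/eqP; lia.
    have uk1 : u' k.+1 = Some (Pi x, n'') by rewrite /u' /update eqxx.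
    rewrite (guarded_sat_conn true Pi u' (qys1 := [::])) //; last first.
      by move=> z /m0fv[]->; apply/negP => /ks; lia.
    rewrite /conn (satm _ _ _ uk) /m0.
    have := fo_sat_FLt_full uy' uk; have := fo_sat_FLt_full uy' uk1.
    by have := fo_sat_FLt_full uk1 uk; rewrite /= => -> -> ->.
  rewrite [guarded_sat _ _ _ _]/=; split.
    (* The instance 0 gives n < n', and the instance n+1 excludes n+1 < n'. *)
    move=> [n' all_n]; have [[nn' _]] := (E n' 0).1 (all_n 0).
    have [[_ btw]] := (E n' n.+1).1 (all_n n.+1).
    have -> : n' = n.+1 by case: btw; lia.
    by rewrite /ltl_at /= shift_suffix addn1.
  rewrite /ltl_at /= shift_suffix addn1 => sat; exists n.+1 => n''; apply/E.
  by split=> //; split=> //; have [|] := ltnP n n''; [right|left]; lia.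
have fv1 : {subset ltl_fv psi1 <= xs} by move=> z fz; apply: fv; rewrite mem_cat fz.
have fv2 : {subset ltl_fv psi2 <= xs} by move=> z fz; apply: fv; rewrite mem_cat fz orbT.
have [qys2 [m2 [qm2 g2 k2 fvm2 sat2]]] := IH2 x k k.+2 fv2 xsx (leqnSn _).
have [k' kk' below] := bound_below qys2 k.+2.
have [qys1 [m1 [qm1 g1 k1 fvm1 sat1]]] := IH1 x k.+1 k' fv1 xsx kk'.
(* Here [k] is the time at which [psi2] holds, and [k.+1] ranges over all times: either it is not in
   [y, k), which is [m3], or [psi1] holds there. *)
pose m0 := FLe AP y k; pose m3 := FNot (FAnd (FLe AP y k.+1) (FLt AP k.+1 k)).
exists [:: (QEx, k, x), (QAll, k.+1, x) & qys2 ++ qys1],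
  (FConn true m0 (FConn true m2 (FConn false m3 m1))).
have m0fv z : z \in fo_fv m0 -> z = y \/ z = k.
  by rewrite /= !inE => /or4P[]/eqP; [left|right|left|right].
have m3fv z : z \in fo_fv m3 -> [\/ z = y, z = k | z = k.+1].
  rewrite /= !inE => m3z; have /or3P : [|| z == y, z == k | z == k.+1] by lia.
  by case=> /eqP; [constructor 1|constructor 2|constructor 3].
have m31fv z : z \in fo_fv (FConn false m3 m1) -> [\/ z = y, z = k, z = k.+1 | z \in bound qys1].
  rewrite fo_fv_conn mem_cat => /orP[/m3fv[]|/fvm1[]];
    by [constructor 1|constructor 2|constructor 3|constructor 4].
have m231fv z : z \in fo_fv (FConn true m2 (FConn false m3 m1)) ->
    [\/ z = y, z = k, z = k.+1 | z \in bound (qys2 ++ qys1)].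
  have sub1 : z \in bound qys1 -> z \in bound (qys2 ++ qys1).
    by rewrite map_cat mem_cat => ->; rewrite orbT.
  have sub2 : z \in bound qys2 -> z \in bound (qys2 ++ qys1).
    by rewrite map_cat mem_cat => ->.
  rewrite fo_fv_conn mem_cat => /orP[/fvm2[|/sub2]|/m31fv[| | |/sub1]];
    by [constructor 1|constructor 2|constructor 3|constructor 4].
split.
- by rewrite /= qm2 qm1.
- move=> z; rewrite /= map_cat !inE mem_cat.
  by move=> /or4P[/eqP->|/eqP->|/g2|/g1].
- move=> z; rewrite /= map_cat !inE mem_cat.
  by move=> /or4P[/eqP->|/eqP->|/k2|/k1]; lia.
- move=> z; rewrite fo_fv_conn mem_cat => /orP[/m0fv[]->|/m231fv[->|->|->|zb]];
    rewrite /= ?inE ?eqxx ?orbT ?zb ?orbT; first [by left | by right].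
move=> Pi u n uy.
have E n' n'' : guarded_sat Pi (update (update u k (Pi x, n')) k.+1 (Pi x, n''))
    (qys2 ++ qys1) (FConn true m0 (FConn true m2 (FConn false m3 m1))) <->
    [/\ n <= n', ltl_at Pi n' psi2 & ~ (n <= n'' /\ n'' < n') \/ ltl_at Pi n'' psi1].
  set u' := update _ _ _.
  have uy' : u' y = Some (Pi x, n) by rewrite /u' /update !ifN //; apply/eqP; lia.
  have uk : u' k = Some (Pi x, n').
    by rewrite /u' /update eqxx ifN //; apply/eqP; lia.
  have uk1 : u' k.+1 = Some (Pi x, n'') by rewrite /u' /update eqxx.
  rewrite (guarded_sat_conn true Pi u' (qys1 := [::])) //; last 2 first.
  - by rewrite /= qm2 qm1.
  - move=> z /m0fv zyk; rewrite map_cat mem_cat; apply/negP => /orP[/k2|/k1]; lia.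
  rewrite guarded_sat_conn //; last 2 first.
  - by move=> z /fvm2[->|/below]; [apply/negP => /k1|apply: contraTN => /k1]; lia.
  - move=> z /m31fv[->|->|->|/k1]; [apply/negP => /k2; lia..|].
    by apply: contraTN => /below; lia.
  rewrite (@guarded_sat_conn false Pi u' [::] qys1 m3 m1) //; last first.
    by move=> z /m3fv[]->; apply/negP => /k1; lia.
  rewrite /conn (sat2 _ _ _ uk) (sat1 _ _ _ uk1).
  have E0 : guarded_sat Pi u' [::] m0 <-> n <= n' by exact: fo_sat_FLe_full uy' uk.
  have E3 : guarded_sat Pi u' [::] m3 <-> ~ (n <= n'' /\ n'' < n').
    have Ele := fo_sat_FLe_full uy' uk1; have Elt := fo_sat_FLt_full uk1 uk.
    rewrite -Ele -Elt; exact: iff_refl.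
  by rewrite E0 E3; split=> [[? []]|[]].
rewrite [guarded_sat _ _ _ _]/= ltl_at_until; split.
  move=> [n' all_n]; have [nn' s2 _] := (E n' 0).1 (all_n 0).
  exists n'; split=> // j /andP[nj jn'].
  by have [_ _ [[]|]] := (E n' j).1 (all_n j).
move=> [n' [nn' s1 s2]]; exists n' => n''; apply/E; split=> //.
have [/andP nn''|nn''] := boolP (n <= n'' < n'); first by right; apply: s1; apply/andP.
by left=> /andP nn3; rewrite nn3 in nn''.
Qed.

Lemma hyperltl_hprefix (phi : hyperltl AP) : exists qxs psi, phi = hprefix qxs psi.
Proof.
elim: phi => [p phi [qxs [psi ->]]|p phi [qxs [psi ->]]|psi].
- by exists ((QEx, p) :: qxs), psi.
- by exists ((QAll, p) :: qxs), psi.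
by exists [::], psi.
Qed.

Lemma sub_hprefix_fv qxs psi x : x \in ltl_fv psi ->
  x \notin [seq q.2 | q <- qxs] -> x \in hyperltl_fv (hprefix qxs psi).
Proof.
move=> fx; elim: qxs => //= -[[] y] qxs IHq /=; rewrite inE negb_or => /andP[xy nx];
by rewrite mem_filter xy IHq.
Qed.

(** In the absence of truth constants, a sentence quantifies at least one trace. *)
Lemma ltl_fv_nonempty psi : exists x, x \in ltl_fv psi.
Proof.
elim: psi => //= [a p|psi1 [x fx] psi2 _|psi1 [x fx] psi2 _].
- by exists p; exact: mem_head.
- by exists x; rewrite mem_cat fx.
by exists x; rewrite mem_cat fx.
Qed.

Lemma FMin_fv y : {subset fo_fv (FMin AP y) <= [:: y]}.
Proof.
pose t := (maxn y.+1 y).+1; move=> z.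
rewrite -[fo_fv _]/[seq w <- [:: y.+1; y] ++
  [seq w <- [:: y.+1; t; t; y] | w != t] | w != y.+1].
rewrite mem_filter mem_cat mem_filter !inE => /andP[/negPf ->].
by case: (z == t); rewrite /= ?orbF ?orbb.
Qed.

Lemma FPrefixG_fv qys m x : x \in fo_fv (FPrefixG qys m) ->
  x \in [seq q.2 | q <- qys] \/ x \in fo_fv m /\ x \notin bound qys.
Proof.
elim: qys => [|[[Q y] z] qys IHq] /=; first by right.
have -> : fo_fv (FQuantG Q y z (FPrefixG qys m)) =
  [seq w <- [:: z; y; z; y] ++ fo_fv (FPrefixG qys m) | w != y] by case: Q.
rewrite mem_filter mem_cat !inE negb_or => /andP[xy /orP[]].
  by rewrite (negPf xy) !orbF orbb => ->; left.
by move=> /IHq[->|[-> ->]]; rewrite ?xy ?orbT; [left|right].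
Qed.

Lemma FPrefixM_fv (qxs : seq (quantifier * var)) m x : x \in fo_fv (FPrefixM qxs m) ->
  x \in fo_fv m /\ x \notin [seq q.2 | q <- qxs].
Proof.
elim: qxs => [|[Q y] qxs IHq] //=.
have -> : fo_fv (FQuantM Q y (FPrefixM qxs m)) =
  [seq w <- fo_fv (FMin AP y) ++ fo_fv (FPrefixM qxs m) | w != y] by case: Q.
rewrite mem_filter mem_cat inE negb_or => /andP[xy /orP[/FMin_fv|/IHq[-> ->]]].
  by rewrite inE (negPf xy).
by rewrite xy.
Qed.

Lemma prefix_sentence qxs qys m :
  {subset [seq q.2 | q <- qys] <= [seq q.2 | q <- qxs]} ->
  {subset fo_fv m <= bound qys} -> fo_sentence (FPrefixM qxs (FPrefixG qys m)).
Proof.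
move=> guards fvm; rewrite /fo_sentence.
case E: fo_fv => [//|x s]; have := @FPrefixM_fv qxs (FPrefixG qys m) x.
by rewrite E mem_head => /(_ isT)[/FPrefixG_fv[/guards ->//|[/fvm ->]]].
Qed.

(** The matrix of a HyperFO sentence may mention only guarded variables, so time 0 must itself be
    introduced by a guarded variable on some quantified trace. *)
Lemma hyperltl_to_hyperfo (phi : hyperltl AP) : hyperltl_sentence phi ->
  exists m : fo AP, hyperfo m /\
    forall T, hyperltl_models T phi <-> fo_models (trace_structure T) m.
Proof.
have [qxs [psi ->]] := hyperltl_hprefix phi.
set xs := [seq q.2 | q <- qxs] => closed.
have fv : {subset ltl_fv psi <= xs}.
  move=> x fx; apply: contraT => nx; have := sub_hprefix_fv fx nx.
  by rewrite closed.
have [x0 /fv xsx0] := ltl_fv_nonempty psi.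
have xs0 : xs <> [::] by move=> E; rewrite E in xsx0.
(* Names from [k] on are distinct from all trace variables; [k] is the initial time, [k.+1] its
   competitor, and the translation of [psi] starts at [k.+2]. *)
pose k := (\max_(x <- xs) x).+1.
have xsk x : x \in xs -> x < k by move=> xsx; rewrite ltnS (leq_bigmax_seq _ xsx).
have [qys [m [qm gxs ks fvm satm]]] := ltl_prenex (y := k) (k := k.+2) fv xsx0 (leqnSn k.+1).
(* The first two quantifiers state that [k] denotes the least position. *)
pose qys' := [:: (QEx, k, x0), (QAll, k.+1, x0) & qys].
pose m' := FConn true (FLe AP k k.+1) m.
have gxs' : {subset [seq q.2 | q <- qys'] <= xs}.
  by move=> z; rewrite !inE => /or3P[/eqP->|/eqP->|/gxs].
have fvm' : {subset fo_fv m' <= bound qys'}.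
  move=> z; rewrite fo_fv_conn mem_cat => /orP[|/fvm[->|zb]].
  - by rewrite /= !inE => /or4P[]/eqP->; rewrite eqxx ?orbT.
  - by rewrite /= inE eqxx.
  - by rewrite /= !inE zb !orbT.
have disj : {in bound qys' & [seq q.2 | q <- qys'], forall y x, y != x}.
  move=> y x; rewrite /= !inE => yb /gxs'/xsk xk.
  by case/or3P: yb => [/eqP->|/eqP->|/ks]; lia.
exists (FPrefixM qxs (FPrefixG qys' m')); split.
  split; first exact: prefix_sentence.
  exists qxs, qys', m'; split=> //.
  apply/hasPn => y yb; apply/negP => /= /xsk.
  by move: yb; rewrite /= !inE => /or3P[/eqP->|/eqP->|/ks]; lia.
move=> T; apply: iff_sym; apply: prefix_models => u Pi uPi.
have [Pi' E] := matched_total xs0 uPi.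
rewrite (fo_sat_FPrefixG (Pi := Pi')) //; last first.
  by move=> x /gxs' xsx; have [t [ut]] := uPi _ xsx; rewrite (E _ xsx); exists t.
have -> : ltl_sat Pi psi <-> ltl_at Pi' 0 psi.
  by apply: ltl_sat_agree => x /fv/E ->; congr Some.
have sat n n' : guarded_sat Pi' (update (update (embed u) k (Pi' x0, n)) k.+1 (Pi' x0, n'))
    qys m' <-> n <= n' /\ ltl_at Pi' n psi.
  set u' := update _ _ _.
  have uk : u' k = Some (Pi' x0, n).
    by rewrite /u' /update eqxx ifN //; apply/eqP; lia.
  have uk1 : u' k.+1 = Some (Pi' x0, n') by rewrite /u' /update eqxx.
  rewrite (guarded_sat_conn true Pi' u' (qys1 := [::])) //; last first.
    by move=> z; rewrite /= !inE => /or4P[]/eqP->; apply/negP => /ks; lia.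
  by rewrite /conn (satm _ _ _ uk) -(fo_sat_FLe_full uk uk1).
rewrite [guarded_sat _ _ _ _]/=; split.
  (* The instance 0 of the universal variable forces n = 0. *)
  by move=> [n all_n]; have [] := (sat n 0).1 (all_n 0); rewrite leqn0 => /eqP->.
by move=> sat0; exists 0 => n'; apply/sat.
Qed.

End Prenex.

Theorem theorem8 (AP : finType) (AP_nonempty : 0 < #|AP|) :
  (forall phi : fo AP, hyperfo phi ->
     exists phi' : hyperltl AP, hyperltl_sentence phi' /\
       forall T : set (trace AP),
         fo_models (trace_structure T) phi <-> hyperltl_models T phi') /\
  (forall phi : hyperltl AP, hyperltl_sentence phi ->
     exists phi' : fo AP, hyperfo phi' /\
       forall T : set (trace AP),
         hyperltl_models T phi <-> fo_models (trace_structure T) phi').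
Proof.
split=> [phi|phi]; first exact: hyperfo_to_hyperltl.
exact: hyperltl_to_hyperfo.
Qed.
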